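(* Let $(M,g)$ be an $n$-dimensional semi-Riemannian manifold. (a) Let $V$ be a vector field on $M$ with $g(V,V)\neq 0$ everywhere. If $dV^\flat=0$, then the distribution $D=V^\perp$ is involutive, and for every vector field $X$ in $D$ one has $X(g(V,V))=g(V,[X,V])$. (b) Conversely, let $D$ be an involutive $(n-1)$-dimensional distribution on $M$ and let $V$ be a vector field orthogonal to $D$, with $g(V,V)\ne 0$ everywhere, such that $V\lrcorner\, dV^\flat=0$. Then the $V$-curvature is symmetric, i.e. $\mathcal{R}^V(X,Y,Z,W)=\mathcal{R}^V(Z,W,X,Y)$ for all $X,Y,Z,W$. In this case, writing $|V|:=\sqrt{|g(V,V)|}$, for all vector fields $\xi,\eta$ in $D$: $$\mathrm{Ric}^V(\xi,\eta)-\mathrm{Ric}^g(\xi,\eta)=\Big[H|V|+\tfrac{1}{|V|}V(|V|)+(2-n)\,g(V,V)\Big]g(\xi,\eta)+(n-2)\,|V|\,\mathrm{II}(\xi,\eta),$$ $$\mathrm{Ric}^V(\xi,V)-\mathrm{Ric}^g(\xi,V)=\tfrac{n-2}{2}\,\xi\big(g(V,V)\big),$$ $$\mathrm{Ric}^V(V,V)-\mathrm{Ric}^g(V,V)=g(V,V)\Big(H|V|+(n-1)\tfrac{1}{|V|}V(|V|)\Big).$$ Here $\mathrm{II}$ is the second fundamental form and $H=\mathrm{tr}\,\mathrm{II}$ the mean curvature of the leaves of $D$.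
   Context: Let $\nabla^g$ be the Levi-Civita connection of $(M,g)$, with Ricci tensor $\mathrm{Ric}^g$, and $V^\flat=g(V,\cdot)$. The metric connection with vectorial torsion $V$ is $\nabla_XY=\nabla^g_XY+g(X,Y)V-g(V,Y)X$. Its curvature is $\mathcal{R}^V(X,Y)Z=\nabla_X\nabla_YZ-\nabla_Y\nabla_XZ-\nabla_{[X,Y]}Z$, $\mathcal{R}^V(X,Y,Z,W)=g(\mathcal{R}^V(X,Y)Z,W)$. For an orthonormal basis with $g(e_i,e_j)=\varepsilon_i\delta_{ij}$, $\varepsilon_i=\pm1$, $\mathrm{Ric}^V(X,Y)=\sum_i\varepsilon_i\,g(\mathcal{R}^V(X,e_i)e_i,Y)$, and likewise for $\mathrm{Ric}^g$. Sign convention: with unit normal $N=V/|V|$, the second fundamental form of the leaves of $D$ is $\mathrm{II}(\xi,\eta)=g(\nabla^g_\xi N,\eta)$ for $\xi,\eta\in D$, and $H$ is its trace over $D$ with respect to $g|_D$. *)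

(* Defs.v *)
From HB Require Import structures.
From mathcomp Require Import all_boot all_order all_algebra.
From mathcomp Require Import all_classical all_reals all_analysis.

Set Implicit Arguments.
Unset Strict Implicit.
Unset Printing Implicit Defensive.

Import Order.TTheory GRing.Theory Num.Theory.
Import numFieldNormedType.Exports.

Local Open Scope classical_set_scope.
Local Open Scope ring_scope.

(* C^k and C^oo maps on an open subset U of R^n. *)
Fixpoint Ck (R : realType) (n : nat) (W : normedModType R) (k : nat)
    (U : set 'rV[R]_n) (f : 'rV[R]_n -> W) : Prop :=
  match k with
  | 0 => forall x, U x -> {for x, continuous f}
  | k'.+1 => (forall x, U x -> differentiable f x) /\
             (forall i : 'I_n, Ck k' U (fun x => 'D_(delta_mx 0 i) f x))
  end.

Definition smooth_on (R : realType) (n : nat) (W : normedModType R)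
    (U : set 'rV[R]_n) (f : 'rV[R]_n -> W) : Prop :=
  forall k, Ck k U f.

(* A homeomorphism from an open subset of T onto an open subset of R^n; the
   values of chart_fwd off chart_dom, and of chart_bwd off the image, are junk. *)
Record chart (R : realType) (n : nat) (T : topologicalType) := Chart {
  chart_dom : set T;
  chart_fwd : T -> 'rV[R]_n;
  chart_bwd : 'rV[R]_n -> T;
  chart_dom_open : open chart_dom;
  chart_img_open : open (chart_fwd @` chart_dom);
  chart_fwdK : forall q, chart_dom q -> chart_bwd (chart_fwd q) = q;
  chart_fwd_cont : forall q, chart_dom q -> {for q, continuous chart_fwd};
  chart_bwd_cont : forall q, chart_dom q ->
    {for chart_fwd q, continuous chart_bwd} }.

(* The smooth structure is given by an atlas indexed by the points of M, the
   chart of index p being defined around p.  Any smooth atlas can be so indexed,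
   after discarding redundant charts. *)
Record smooth_manifold (R : realType) (n : nat) := SmoothManifold {
  carrier :> topologicalType;
  manifold_hausdorff : hausdorff_space carrier;
  manifold_second_countable : @second_countable carrier;
  chart_at : carrier -> chart R n carrier;
  chart_at_dom : forall p, chart_dom (chart_at p) p;
  chart_compatible : forall p q, smooth_on
    (chart_fwd (chart_at p) @`
       (chart_dom (chart_at p) `&` chart_dom (chart_at q)))
    (chart_fwd (chart_at q) \o chart_bwd (chart_at p)) }.

Section Manifold.
Context (R : realType) (n : nat) (M : smooth_manifold R n).
Implicit Types (p q : M) (f : M -> R).

(* The tangent space T_pM is R^n: x stands for the tangent vector with
   components x in the coordinate system chart_at p. *)
Notation TM := 'rV[R]_n.
Implicit Types (x y : TM) (X Y Z V : M -> TM).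

Definition smooth_at p f : Prop :=
  exists2 U, open_nbhs (chart_fwd (chart_at p) p) U &
    smooth_on U (f \o chart_bwd (chart_at p)).

(* The derivative x(f) of f along the tangent vector x at p. *)
Definition tderiv f p x : R :=
  'd (f \o chart_bwd (chart_at p)) (chart_fwd (chart_at p) p) x.

(* The function X(f). *)
Definition act X f : M -> R := fun p => tderiv f p (X p).

(* X is smooth near p: X(f) is smooth near p for every f smooth near p. Off a
   neighbourhood of p the values of X are irrelevant, so the X such that
   vf_smooth_at p X are the local vector fields around p, extended by junk. *)
Definition vf_smooth_at p X : Prop :=
  forall f, smooth_at p f -> smooth_at p (act X f).

Definition vector_field X : Prop := forall p, vf_smooth_at p X.

Definition coord p (j : 'I_n) : M -> R :=
  fun q => chart_fwd (chart_at p) q 0 j.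

(* [X, Y] f = X (Y f) - Y (X f), on the coordinate functions f at p. *)
Definition bracket X Y : M -> TM := fun p =>
  \row_j (act X (act Y (coord p j)) p - act Y (act X (coord p j)) p).

(* Exterior derivative of the 1-form a, evaluated on (X, Y). *)
Definition dform (a : M -> TM -> R) X Y : M -> R := fun p =>
  act X (fun q => a q (Y q)) p - act Y (fun q => a q (X q)) p
  - a p (bracket X Y p).

Definition is_distribution (k : nat) (D : M -> {vspace TM}) : Prop :=
  (forall p, \dim (D p) = k) /\
  (forall p, exists F : 'I_k -> M -> TM,
     (forall i, vf_smooth_at p (F i)) /\
     (\forall q \near p, D q = <<codom (fun i => F i q)>>%VS)).

Definition section_at (D : M -> {vspace TM}) p X : Prop :=
  vf_smooth_at p X /\ \forall q \near p, X q \in D q.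

Definition is_involutive (D : M -> {vspace TM}) : Prop :=
  forall p X Y, section_at D p X -> section_at D p Y ->
    bracket X Y p \in D p.

(* nu is the index of the symmetric bilinear form b: the largest dimension of a
   subspace on which b is negative definite. *)
Definition neg_def_on (b : TM -> TM -> R) (U : {vspace TM}) : Prop :=
  forall x, x \in U -> x != 0 -> b x x < 0.

Definition has_index (b : TM -> TM -> R) (nu : nat) : Prop :=
  (exists2 U, neg_def_on b U & \dim U = nu) /\
  (forall U, neg_def_on b U -> (\dim U <= nu)%N).

Record semi_riemannian_metric := SemiRiemannianMetric {
  metric :> M -> TM -> TM -> R;
  metric_linear : forall p a x y z,
    metric p (a *: x + y) z = a * metric p x z + metric p y z;
  metric_sym : forall p x y, metric p x y = metric p y x;
  metric_nondegenerate : forall p x, (forall y, metric p x y = 0) -> x = 0;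
  metric_index : exists nu, forall p, has_index (metric p) nu;
  metric_smooth : forall p X Y, vf_smooth_at p X -> vf_smooth_at p Y ->
    smooth_at p (fun q => metric q (X q) (Y q)) }.

(* nabla Y p x is the covariant derivative at p, along the tangent vector x, of
   the vector field Y defined around p. *)
Definition cov (nabla : (M -> TM) -> M -> TM -> TM) X Y : M -> TM :=
  fun p => nabla Y p (X p).

Record is_connection (nabla : (M -> TM) -> M -> TM -> TM) : Prop := {
  connection_linear : forall p Y a x y, vf_smooth_at p Y ->
    nabla Y p (a *: x + y) = a *: nabla Y p x + nabla Y p y;
  connection_add : forall p Y Z x, vf_smooth_at p Y -> vf_smooth_at p Z ->
    nabla (fun q => Y q + Z q) p x = nabla Y p x + nabla Z p x;
  connection_leibniz : forall p f Y x, smooth_at p f -> vf_smooth_at p Y ->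
    nabla (fun q => f q *: Y q) p x
      = tderiv f p x *: Y p + f p *: nabla Y p x;
  connection_smooth : forall p X Y, vf_smooth_at p X -> vf_smooth_at p Y ->
    vf_smooth_at p (cov nabla X Y) }.

Definition curvature (nabla : (M -> TM) -> M -> TM -> TM) X Y Z : M -> TM :=
  fun p => cov nabla X (cov nabla Y Z) p - cov nabla Y (cov nabla X Z) p
           - cov nabla (bracket X Y) Z p.

Section Metric.
Variable g : semi_riemannian_metric.

Record is_levi_civita (nabla : (M -> TM) -> M -> TM -> TM) : Prop := {
  levi_civita_connection : is_connection nabla;
  levi_civita_torsion_free : forall p X Y,
    vf_smooth_at p X -> vf_smooth_at p Y ->
    cov nabla X Y p - cov nabla Y X p = bracket X Y p;
  levi_civita_metric : forall p x Y Z, vf_smooth_at p Y -> vf_smooth_at p Z ->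
    tderiv (fun q => g q (Y q) (Z q)) p x
      = g p (nabla Y p x) (Z p) + g p (Y p) (nabla Z p x) }.

Definition inner X Y : M -> R := fun p => g p (X p) (Y p).

Definition flat V : M -> TM -> R := fun p => g p (V p).

Definition vnorm V : M -> R := fun p => Num.sqrt `|inner V V p|.

Definition perp V : M -> {vspace TM} :=
  fun p => lker (linfun (flat V p : TM -> R^o)).

Definition orthonormal_basis p (U : {vspace TM}) (m : nat) (e : 'I_m -> TM) :
    Prop :=
  [/\ basis_of U (codom e),
      forall i j, i != j -> g p (e i) (e j) = 0 &
      forall i, g p (e i) (e i) = 1 \/ g p (e i) (e i) = - 1].

(* Trace of the bilinear form b on U with respect to g restricted to U, computed
   in some orthonormal basis e of U, with signs g(e_i, e_i). *)
Definition metric_trace p (U : {vspace TM}) (b : TM -> TM -> R) : R :=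
  let e := xget (fun=> 0) [set e : 'I_(\dim U) -> TM | orthonormal_basis p U e] in
  \sum_i g p (e i) (e i) * b (e i) (e i).

Definition curvature4 nabla X Y Z W : M -> R :=
  inner (curvature nabla X Y Z) W.

(* At p, computed with local vector fields E_i around p whose values at p are an
   orthonormal basis of T_pM. *)
Definition ricci nabla X Y : M -> R := fun p =>
  let E := xget (fun _ _ => 0) [set E : 'I_n -> M -> TM |
    (forall i, vf_smooth_at p (E i)) /\
    orthonormal_basis p fullv (fun i => E i p)] in
  \sum_i g p (E i p) (E i p) * curvature4 nabla X (E i) (E i) Y p.

(* The metric connection with vectorial torsion V. *)
Definition vectorial (nabla : (M -> TM) -> M -> TM -> TM) V :
    (M -> TM) -> M -> TM -> TM := fun Y p x =>
  nabla Y p x + g p x (Y p) *: V p - g p (V p) (Y p) *: x.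

(* Second fundamental form at p, on tangent vectors, of the leaves of V^perp
   with respect to the unit normal V / |V|. *)
Definition second_ff (nabla : (M -> TM) -> M -> TM -> TM) V p x y : R :=
  g p (nabla (fun q => (vnorm V q)^-1 *: V q) p x) y.

Definition mean_curvature nabla (D : M -> {vspace TM}) V : M -> R :=
  fun p => metric_trace p (D p) (second_ff nabla V p).

End Metric.
End Manifold.

(* Main.v *)
From HB Require Import structures.
Require Import Defs.
From mathcomp Require Import all_boot all_order all_algebra.
From mathcomp Require Import all_classical all_reals all_analysis.
From mathcomp Require Import ring lra.
Import Order.TTheory GRing.Theory Num.Theory.
Import numFieldNormedType.Exports.
Local Open Scope classical_set_scope.
Local Open Scope ring_scope.
Set Implicit Arguments.
Unset Strict Implicit.
Unset Printing Implicit Defensive.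

(** Let [S(x, y) = g(nabla_x V, y)].  In part (b) the form [S] is symmetric:
    on [D] because [D] is involutive and [nabla] torsion free, and between [V]
    and any vector because [V] contracts [dV^b] to [0].  The difference
    [R^V - R^g] is an explicit tensor in [g], [V] and [S] ([curvature_defect]),
    which is invariant under exchange of pairs as soon as [S] is symmetric, and
    whose trace gives
    [Ric^V - Ric^g = (n - 2) S + (tr S + (2 - n) g(V, V)) g + (n - 2) V^b V^b].
    Finally [S = |V| II] on [D], [S(V, V) = g(V, V) V(|V|) / |V|], and
    [tr S = |V| H + S(V, V) / g(V, V)].

    The pair symmetry of [R^g] needs that [[X, Y]] acts on functions as a
    commutator, which in charts is the equality of mixed second derivatives. *)

(** * C^k maps on open subsets of R^n *)

Section CkCalculus.
Context (R : realType).

(** A tangent vector at [q] is stored by its components in the chart at [q], so moving the point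
    changes the chart: statements near [p] are carried through a transition map before calculus on
    R^n applies, and fields are handled by their action on functions. Locality is not an axiom of
    [is_connection], and the proof never replaces a field under [nabla] by one that merely agrees
    with it near [p]. Hence the symmetries of R^g are stated for global fields, for which the
    identities rewritten under [nabla] hold at every point. The comparison of R^V with R^g rewrites
    only by unfolding [vectorial], and so reaches fields smooth just around [p], such as the frames
    of [ricci]. [ricci] and [metric_trace] obtain their bases by choice, unrelated to each other; tr
    S passes from one to the other by an invariance lemma for weighted families of vectors. *)

Lemma near_eq_diff (V W : normedModType R) (f g : V -> W) (x : V) :
  (\forall y \near x, f y = g y) -> differentiable f x ->
  differentiable g x /\ ('d g x = 'd f x :> (V -> W)).
Proof.
move=> fg df; have fgx : f x = g x by exact: nbhs_singleton fg.
have dfc : continuous ('d f x) by apply: diff_continuous.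
(* Near 0 the remainders of [f] and [g] are the same function, so [g] inherits the expansion of
   [f]. *)
have H : g \o shift x = cst (g x) + 'd f x +o_ 0 id.
  apply/eqaddoP => e e0.
  have /eqaddoP/(_ e e0) H0 := diff_locally df.
  have fg' : \forall h \near (0 : V), f (h + x) = g (h + x).
    move: fg; rewrite (near_shift 0 x) /=; apply: filterS => h.
    by rewrite /= subr0.
  near=> h.
  have -> : (g \o shift x - (cst (g x) + 'd f x)) h =
            (f \o shift x - (cst (f x) + 'd f x)) h.
    rewrite !fctE /= -fgx; congr (_ - _); apply/esym; near: h; exact: fg'.
  by near: h.
have E := diff_unique dfc H; split; last exact: E.
by apply/diff_locallyP; rewrite E.
Unshelve. all: by end_near. Qed.

(** The chain rule as charts supply it: a function read in one chart is a composite with a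
    transition map only near the point, since the chart inverses cancel only on the chart
    domains. *)
Lemma diff_comp_near (V W Z : normedModType R) (F : V -> Z) (f : V -> W)
    (g : W -> Z) (x v : V) (y : W) :
  f x = y -> (\forall z \near x, F z = g (f z)) ->
  differentiable f x -> differentiable g y -> 'd F x v = 'd g y ('d f x v).
Proof.
move=> <- E df dg.
have E' : \forall z \near x, (g \o f) z = F z by apply: filterS E => z ->.
have [_ D] := near_eq_diff E' (differentiable_comp df dg).
exact: etrans (congr1 (@^~ v) D) (congr1 (@^~ v) (diff_comp df dg)).
Qed.

Lemma diff_near_id (V : normedModType R) (F : V -> V) (x v : V) :
  (\forall z \near x, F z = z) -> 'd F x v = v.
Proof.
move=> E; have E' : \forall z \near x, id z = F z by apply: filterS E => z ->.
have did : is_diff x (@id V) id by apply: is_diff_id.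
have [_ D] := near_eq_diff E' (@ex_diff _ _ _ _ _ _ _ did).
exact: etrans (congr1 (@^~ v) D) (congr1 (@^~ v) (@diff_val _ _ _ _ _ _ _ did)).
Qed.

Lemma diff_coord (V : normedModType R) (m : nat) (f : V -> 'rV[R]_m) (x v : V) j :
  differentiable f x ->
  differentiable (fun y => f y 0 j) x /\
  'd (fun y => f y 0 j : R) x v = 'd f x v 0 j.
Proof.
move=> df.
have dc := @differentiable_coord _ _ _ (f x) 0 j.
have D : differentiable (fun y => f y 0 j : R) x.
  exact: (differentiable_comp df dc).
split=> //; rewrite -!deriveE // derive_mx ?mxE //.
by apply: diff_derivable.
Qed.

Context (n : nat).
Implicit Types (U : set 'rV[R]_n).

Lemma Ck_ext (W : normedModType R) k U (f g : 'rV[R]_n -> W) : open U ->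
  (forall x, U x -> f x = g x) -> Ck k U f -> Ck k U g.
Proof.
move=> oU; elim: k f g => [|k IH] f g fg /=.
  move=> fc x Ux; have Ux' : \forall y \near x, f y = g y.
    by have := oU x Ux; apply: filterS.
  change (g @ x --> g x); rewrite -(fg x Ux).
  exact: cvg_trans (near_eq_cvg (F := nbhs x) Ux') (fc x Ux).
move=> [df Df]; split=> [x Ux|i].
  by have [] := near_eq_diff (filterS fg (oU x Ux)) (df x Ux).
apply: IH (Df i) => x Ux; apply: near_eq_derive.
exact: filterS (oU x Ux).
Qed.

Lemma Ck_sub (W : normedModType R) k U U' (f : 'rV[R]_n -> W) : U' `<=` U ->
  Ck k U f -> Ck k U' f.
Proof.
move=> UU'; elim: k f => [|k IH] f /=; first by move=> fc x /UU' /fc.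
by move=> [df Df]; split=> [x /UU' /df //|i]; apply: IH.
Qed.

Lemma CkW (W : normedModType R) k U (f : 'rV[R]_n -> W) :
  Ck k.+1 U f -> Ck k U f.
Proof.
elim: k f => [|k IH] f [df Df].
  by move=> x Ux; apply: differentiable_continuous; apply: df.
by split=> // i; apply: IH; apply: Df.
Qed.

Lemma Ck_cst (W : normedModType R) k U (a : W) :
  Ck k U (fun=> a : W).
Proof.
elim: k a => [|k IH] a /=; first by move=> x _; apply: cst_continuous.
split=> [x _|i]; first exact: differentiable_cst.
suff -> : (fun x : 'rV[R]_n => 'D_(delta_mx 0 i) (fun=> a) x) = (fun=> 0 : W) by exact: IH.
by apply/funext=> x; rewrite derive_cst.
Qed.

Lemma CkD (W : normedModType R) k U (f g : 'rV[R]_n -> W) : open U ->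
  Ck k U f -> Ck k U g -> Ck k U (fun x => f x + g x).
Proof.
move=> oU; elim: k f g => [|k IH] f g /=.
  by move=> fc gc x Ux; apply: continuousD; [apply: fc|apply: gc].
move=> [df Df] [dg Dg]; split=> [x Ux|i].
  by apply: differentiableD; [apply: df|apply: dg].
apply: (Ck_ext oU) (IH _ _ (Df i) (Dg i)) => x Ux /=.
by rewrite deriveD //; apply: diff_derivable; [apply: df|apply: dg].
Qed.

Lemma Ck_sum (W : normedModType R) k U m (F : 'I_m -> 'rV[R]_n -> W) : open U ->
  (forall j, Ck k U (F j)) -> Ck k U (fun x => \sum_j F j x).
Proof.
move=> oU; elim: m F => [|m IH] F FC.
  rewrite (_ : (fun _ => _) = fun=> 0); first exact: Ck_cst.
  by apply/funext=> x; rewrite big_ord0.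
rewrite (_ : (fun _ => _) = fun x => F ord0 x + \sum_j F (lift ord0 j) x).
  by apply: CkD => //; apply: IH.
by apply/funext=> x; rewrite big_ord_recl.
Qed.

Lemma CkM k U (f g : 'rV[R]_n -> R) : open U ->
  Ck k U f -> Ck k U g -> Ck k U (fun x => f x * g x).
Proof.
move=> oU; elim: k f g => [|k IH] f g /=.
  by move=> fc gc x Ux; apply: continuousM; [apply: fc|apply: gc].
move=> fC gC; have [df Df] := fC; have [dg Dg] := gC; split=> [x Ux|i].
  by apply: differentiableM; [apply: df|apply: dg].
have H1 := IH _ _ (CkW fC) (Dg i); have H2 := IH _ _ (CkW gC) (Df i).
apply: (Ck_ext oU) (CkD oU H1 H2) => x Ux /=.
by rewrite deriveM //; apply: diff_derivable; [apply: df|apply: dg].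
Qed.

Lemma Ck_coord k U m (f : 'rV[R]_n -> 'rV[R]_m) j : open U ->
  Ck k U f -> Ck k U (fun x => f x 0 j : R).
Proof.
move=> oU; elim: k f => [|k IH] f /=.
  move=> fc x Ux.
  apply: (@continuous_comp _ _ _ f (fun N : 'rV[R]_m => N 0 j : R)); first exact: fc.
  exact: coord_continuous.
move=> [df Df]; split=> [x Ux|i].
  by have [] := diff_coord 0 j (df x Ux).
apply: (Ck_ext oU) (IH _ (Df i)) => x Ux /=.
have [D1 D2] := diff_coord (delta_mx 0 i) j (df x Ux).
by rewrite !deriveE // -?D2 //; apply: df.
Qed.

(** By the chain rule, a partial derivative of the composite is a finite sum of products of a
    partial derivative of [phi] with a partial derivative of [f] taken at [phi x]; the induction
    hypothesis covers the latter. *)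
Lemma Ck_comp k m U (U' : set 'rV[R]_m) (f : 'rV[R]_m -> R) (phi : 'rV[R]_n -> 'rV[R]_m) :
  open U -> (forall x, U x -> U' (phi x)) ->
  Ck k U phi -> Ck k U' f -> Ck k U (fun x => f (phi x)).
Proof.
move=> oU UU'; elim: k f => [|k IH] f pC fC.
  move=> x Ux; apply: (@continuous_comp _ _ _ phi f); first exact: pC.
  exact: fC (UU' x Ux).
have [dp Dp] := pC; have [df Df] := fC; split=> [x Ux|i].
  by apply: (@differentiable_comp _ _ _ _ phi f); [apply: dp|apply/df/UU'].
have H : Ck k U (fun x => \sum_j 'D_(delta_mx 0 i) phi x 0 j *
                           'D_(delta_mx 0 j) f (phi x)).
  apply: Ck_sum => // j; apply: CkM => //.
    exact: (Ck_coord j oU (Dp i)).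
  exact: (IH _ (CkW pC) (Df j)).
apply: (Ck_ext oU) H => x Ux /=.
have d1 := dp x Ux; have d2 := df _ (UU' x Ux).
rewrite !deriveE //; last exact: (@differentiable_comp _ _ _ _ phi f).
rewrite (@diff_comp _ _ _ _ phi f) //= [in RHS](row_sum_delta ('d phi x (delta_mx 0 i))).
rewrite linear_sum; apply: eq_bigr => j _.
by rewrite linearZ deriveE.
Qed.

Lemma Ck_inv k U (f : 'rV[R]_n -> R) : open U ->
  (forall x, U x -> f x != 0) -> Ck k U f -> Ck k U (fun x => (f x)^-1).
Proof.
move=> oU f0; elim: k f f0 => [|k IH] f f0 fC.
  by move=> x Ux; apply: continuousV; [apply: f0|apply: fC].
have [df Df] := fC; split=> [x Ux|i].
  by apply: differentiableV; [apply: df|apply: f0].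
have H0 := IH _ f0 (CkW fC).
(* The derivative of 1/f is -(1/f)(1/f) Df, where 1/f recurs at order [k] only. *)
have H := CkM oU (Ck_cst _ _ (-1 : R)) (CkM oU (CkM oU H0 H0) (Df i)).
apply: (Ck_ext oU) H => x Ux /=.
rewrite deriveV //; [|exact: f0|by apply: diff_derivable; apply: df].
rewrite /GRing.scale /= expr2 invfM; ring.
Qed.

Lemma diff_sqrt (V : normedModType R) (f : V -> R) (x v : V) :
  0 < f x -> differentiable f x ->
  differentiable (fun y => Num.sqrt (f y)) x /\
  'D_v (fun y => Num.sqrt (f y)) x = 'D_v f x * (Num.sqrt (f x) * 2)^-1.
Proof.
move=> f0 df; have ds := is_derive1_sqrt f0.
have ds' : differentiable (Num.sqrt : R -> R) (f x).
  by apply/derivable1_diffP; apply: ex_derive.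
have D := differentiable_comp df ds'; split=> //.
rewrite (deriveE _ D) (deriveE _ df) (diff_comp df ds') /=.
by rewrite (diff1E ds') derive1E derive_val [in RHS](mulrC _ 2).
Qed.

Lemma Ck_sqrt k U (f : 'rV[R]_n -> R) : open U ->
  (forall x, U x -> 0 < f x) -> Ck k U f -> Ck k U (fun x => Num.sqrt (f x)).
Proof.
move=> oU f0; elim: k => [|k IH] fC.
  move=> x Ux; apply: (@continuous_comp _ _ _ f Num.sqrt); first exact: fC.
  exact: sqrt_continuous.
have [df Df] := fC; split=> [x Ux|i].
  by have [] := diff_sqrt 0 (f0 x Ux) (df x Ux).
have H0 := CkM oU (IH (CkW fC)) (Ck_cst k U (2 : R)).
have H1 : forall x, U x -> Num.sqrt (f x) * 2 != 0.
  by move=> x /f0 fx0; rewrite mulf_neq0 ?sqrtr_eq0 -?ltNge.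
apply: (Ck_ext oU) (CkM oU (Df i) (Ck_inv oU H1 H0)) => x Ux /=.
by have [_ ->] := diff_sqrt (delta_mx 0 i) (f0 x Ux) (df x Ux).
Qed.

(** * Symmetry of mixed second derivatives *)

Lemma is_derive_line (V : normedModType R) (g : V -> R) (a w : V) (s : R) :
  differentiable g (a + s *: w) ->
  is_derive s 1 (fun t => g (a + t *: w)) ('D_w g (a + s *: w)).
Proof.
move=> dg.
have dl : is_diff s (fun t : R => a + t *: w) (fun t => t *: w).
  have h : is_diff s (cst a + *:%R^~ w) (0 + *:%R^~ w) by apply: is_diffD.
  by apply: is_diff_eq; rewrite add0r.
have D : differentiable (fun t : R => g (a + t *: w)) s.
  exact: (@differentiable_comp _ _ _ _ (fun t : R => a + t *: w) g).
apply: DeriveDef; first by apply: diff_derivable.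
rewrite !deriveE // (@diff_comp _ _ _ _ (fun t : R => a + t *: w) g) //=.
by rewrite diff_val scale1r.
Qed.

Lemma MVT_line (V : normedModType R) (g : V -> R) (a w : V) (h : R) : 0 < h ->
  (forall s, 0 <= s <= h -> differentiable g (a + s *: w)) ->
  exists2 s, 0 <= s <= h & g (a + h *: w) - g a = h * 'D_w g (a + s *: w).
Proof.
move=> h0 dg.
have [||s] := @MVT R (fun t => g (a + t *: w)) (fun t => 'D_w g (a + t *: w)) 0 h h0.
- move=> s; rewrite in_itv /= => /andP[s0 sh].
  by apply: is_derive_line; apply: dg; rewrite !ltW.
- apply: derivable_within_continuous => s; rewrite in_itv /= => sh.
  by have /(_ _)[|] := is_derive_line (dg s _).
rewrite in_itv /= scale0r addr0 subr0 => /andP[s0 sh] ->.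
by exists s; rewrite 1?mulrC // !ltW.
Qed.

Lemma diff_shift (V : normedModType R) (g : V -> R) (c y w : V) :
  differentiable g (y + c) ->
  differentiable (fun z => g (z + c)) y /\
  'D_w (fun z => g (z + c)) y = 'D_w g (y + c).
Proof.
move=> dg.
have dl : is_diff y (fun z : V => z + c) id.
  have h : is_diff y (id + cst c) (id + 0) by apply: is_diffD.
  by apply: is_diff_eq; rewrite addr0.
have D : differentiable (fun t => g (t + c)) y.
  exact: (@differentiable_comp _ _ _ _ (fun t : V => t + c) g).
split=> //; rewrite !deriveE // (@diff_comp _ _ _ _ (fun t : V => t + c) g) //=.
by rewrite diff_val.
Qed.

(* The mean value theorem along [delta_mx 0 i], then along [delta_mx 0 j]. *)
Lemma second_difference (f : 'rV[R]_n -> R) (i j : 'I_n) U x :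
  open U -> U x -> Ck 2 U f -> forall e : R, 0 < e ->
  \forall h \near (0 : R)^'+,
    `|f (x + h *: delta_mx 0 i + h *: delta_mx 0 j) - f (x + h *: delta_mx 0 i)
      - f (x + h *: delta_mx 0 j) + f x
      - h * h * 'D_(delta_mx 0 j) ('D_(delta_mx 0 i) f) x| <= h * h * e.
Proof.
move=> oU Ux fC e e0; set u : 'rV[R]_n := delta_mx 0 i; set v : 'rV[R]_n := delta_mx 0 j.
have [df /(_ i) [dDf /(_ j) cDDf]] := fC.
have /cvgrPdist_le/(_ e e0) nC : 'D_v ('D_u f) @ x --> 'D_v ('D_u f) x by exact: cDDf.
have [r /= r0 Br] := (nbhs_ballP x _).1 (filterI (oU x Ux) nC).
(* The summand 1 makes the factor positive, hence a legitimate divisor. The bound on [h] keeps the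
   whole parallelogram on [h *: u] and [h *: v] inside the ball where the mixed derivative is
   [e]-close to its value at [x]. *)
have uv0 : 0 < `|u| + `|v| + 1 by rewrite ltr_wpDl ?addr_ge0.
have near_r : \forall h \near (0 : R)^'+, h * (`|u| + `|v| + 1) < r.
  near=> h; rewrite -ltr_pdivlMr //; near: h; apply: nbhs_right_lt.
  exact: divr_gt0.
near=> h.
have h0 : 0 < h by near: h; exact: nbhs_right_gt.
have hr : h * (`|u| + `|v| + 1) < r by near: h.
have inB s t : 0 <= s <= h -> 0 <= t <= h -> ball x r (x + s *: u + t *: v).
  move=> /andP[s0 sh] /andP[t0 th].
  rewrite -ball_normE /ball_ /= -addrA opprD addNKr normrN.
  apply: le_lt_trans hr; apply: le_trans (ler_normD _ _) _.
  rewrite !normrZ (ger0_norm s0) (ger0_norm t0) !mulrDr mulr1.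
  apply: ler_wpDr; first exact: ltW.
  by apply: lerD; apply: ler_wpM2r.
have hh : 0 <= h <= h by rewrite lexx ltW.
have h00 : 0 <= (0 : R) <= h by rewrite lexx ltW.
have d1 s : 0 <= s <= h -> differentiable f (x + s *: u + h *: v).
  by move=> sh; apply/df; have [] := Br _ (inB _ _ sh hh).
have d0 s : 0 <= s <= h -> differentiable f (x + s *: u).
  move=> sh; apply/df; have [+ _] := Br _ (inB _ _ sh h00).
  by rewrite scale0r addr0.
(* The second difference is [g (x + h *: u) - g x], a first difference in the direction [u]. *)
pose g y := f (y + h *: v) - f y.
have dg s : 0 <= s <= h -> differentiable g (x + s *: u).
  move=> sh; apply: differentiableB; last exact: d0.
  by have [] := diff_shift 0 (d1 s sh).
have [s sh Es] := MVT_line h0 dg.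
have Dg : 'D_u g (x + s *: u) = 'D_u f (x + s *: u + h *: v) - 'D_u f (x + s *: u).
  have [D1 D2] := diff_shift u (d1 s sh).
  rewrite deriveB ?D2 //; [exact: diff_derivable|apply: diff_derivable; exact: d0].
have dDf' t : 0 <= t <= h -> differentiable ('D_u f) (x + s *: u + t *: v).
  by move=> th; apply: dDf; have [] := Br _ (inB _ _ sh th).
have [t th Et] := MVT_line h0 dDf'.
have [_ /= Bt] := Br _ (inB _ _ sh th).
have -> : f (x + h *: u + h *: v) - f (x + h *: u) - f (x + h *: v) + f x =
   h * h * 'D_v ('D_u f) (x + s *: u + t *: v).
  move: Es; rewrite Dg Et /g mulrA => <-; ring.
rewrite -mulrBr normrM distrC (@ger0_norm _ (h * h)); last by rewrite mulr_ge0 // ltW.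
by apply: ler_wpM2l => //; rewrite mulr_ge0 // ltW.
Unshelve. all: by end_near. Qed.

Lemma close_quotients (D a b m e : R) : 0 < m ->
  `|D - m * a| <= m * (e / 2) -> `|D - m * b| <= m * (e / 2) -> `|b - a| <= e.
Proof.
move=> m0 A1 A2; rewrite -(ler_pM2l m0) -{1}(gtr0_norm m0) -normrM.
have -> : m * (b - a) = (D - m * a) - (D - m * b) by ring.
have -> : m * e = m * (e / 2) + m * (e / 2) by field.
by apply: le_trans (ler_normB _ _) _; apply: lerD.
Qed.

(** The second difference is symmetric in [i] and [j]. Divided by h^2, for one small h it lies
    within e/2 of each of the two mixed derivatives, and e is arbitrary. *)
Lemma derive_comm (f : 'rV[R]_n -> R) (i j : 'I_n) U x :
  open U -> U x -> Ck 2 U f ->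
  'D_(delta_mx 0 i) ('D_(delta_mx 0 j) f) x =
  'D_(delta_mx 0 j) ('D_(delta_mx 0 i) f) x.
Proof.
move=> oU Ux fC; apply/eqP; rewrite -subr_eq0 -normr_le0.
apply/ler_addgt0Pr => e e0; rewrite add0r.
have e2 : 0 < e / 2 by rewrite divr_gt0.
have H1 := second_difference i j oU Ux fC e2.
have H2 := second_difference j i oU Ux fC e2.
have [h [/= h0 [A1 A2]]] :=
  filter_ex (filterI (nbhs_right_gt (0 : R)) (filterI H1 H2)).
apply: (close_quotients (mulr_gt0 h0 h0) _ A2); rewrite (addrAC x); move: A1.
by rewrite (addrAC _ (- f (x + h *: delta_mx 0 i))).
Qed.

End CkCalculus.

(** * Derivations and vector fields on a manifold *)

Section Manifold.
Context (R : realType) (n : nat) (M : smooth_manifold R n).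
Implicit Types (p q : M) (f h : M -> R) (X Y Z : M -> 'rV[R]_n) (x y : 'rV[R]_n).

Local Notation dom p := (chart_dom (chart_at p)).
Local Notation fwd p := (chart_fwd (chart_at p)).
Local Notation bwd p := (chart_bwd (chart_at p)).

Lemma Ck_id k (U : set 'rV[R]_n) : Ck k U (fun x => x).
Proof.
case: k => [|k] /=; first by move=> x _; apply: cvg_id.
split=> [x _|i]; first by apply: ex_diff.
suff -> : (fun x : 'rV[R]_n => 'D_(delta_mx 0 i) (fun x => x) x) =
   (fun=> delta_mx 0 i : 'rV[R]_n) by exact: Ck_cst.
by apply/funext=> x; rewrite derive_id.
Qed.

(** * Smoothness read in different charts *)

Lemma near_dom p q : dom p q -> \forall r \near q, dom p r.
Proof. by move=> pq; apply: open_nbhs_nbhs; split=> //; exact: chart_dom_open. Qed.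

Lemma near_fwd p q (P : set 'rV[R]_n) : dom p q ->
  nbhs (fwd p q) P -> \forall r \near q, P (fwd p r).
Proof. by move=> pq Pn; have := chart_fwd_cont pq; apply. Qed.

Lemma near_bwd p q (P : set M) : dom p q ->
  nbhs q P -> \forall y \near fwd p q, P (bwd p y).
Proof.
move=> pq Pn; have := chart_bwd_cont pq; apply.
by rewrite chart_fwdK.
Qed.

Lemma near_bwdK p q : dom p q -> \forall y \near fwd p q, fwd p (bwd p y) = y.
Proof.
move=> pq; have : nbhs (fwd p q) (fwd p @` dom p).
  apply: open_nbhs_nbhs; split; first exact: chart_img_open.
  by exists q.
by apply: filterS => _ [r pr <-]; rewrite chart_fwdK.
Qed.

(** [smooth_at] always uses the chart indexed by the point itself; here the chart of [p] stays fixed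
    while [q] varies. *)
Definition smooth_in p q f :=
  exists2 U, open_nbhs (fwd p q) U & smooth_on U (f \o bwd p).

Lemma smooth_on_sub (W : normedModType R) (U U' : set 'rV[R]_n)
    (f : 'rV[R]_n -> W) : U' `<=` U -> smooth_on U f -> smooth_on U' f.
Proof. by move=> UU' fU k; apply: Ck_sub (fU k). Qed.

Lemma open_nbhs_sub (T : topologicalType) (x : T) (A : set T) :
  nbhs x A -> exists2 U, open_nbhs x U & U `<=` A.
Proof. by rewrite nbhsE. Qed.

Lemma transition_smooth p p' q : dom p q -> dom p' q ->
  exists2 U, open_nbhs (fwd p q) U & smooth_on U (fwd p' \o bwd p).
Proof.
move=> pq p'q.
have n1 : nbhs (fwd p q) (fwd p @` dom p).
  by apply: open_nbhs_nbhs; split; [exact: chart_img_open|exists q].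
have n2 := near_bwd pq (near_dom p'q).
have [U oU sU] := open_nbhs_sub (filterI n1 n2).
exists U => //; apply: smooth_on_sub (@chart_compatible _ _ M p p').
move=> y /sU [[r pr <-] /=]; rewrite chart_fwdK // => p'r.
by exists r.
Qed.

(** Near the point, [f \o bwd p'] is [f \o bwd p] composed with the smooth transition map. The
    neighbourhood is cut down so that the transition is smooth, its values stay where [f] is smooth,
    and the charts cancel. *)
Lemma smooth_in_change p p' q f : dom p q -> dom p' q ->
  smooth_in p q f -> smooth_in p' q f.
Proof.
move=> pq p'q [U [oU Uq] fU].
have [Q [opQ Qq] tQ] := transition_smooth p'q pq.
have n1 : nbhs (fwd p' q) Q by apply: open_nbhs_nbhs.
have n2 : \forall y \near fwd p' q, U (fwd p (bwd p' y)).
  have := near_bwd p'q (near_fwd pq (open_nbhs_nbhs (conj oU Uq))).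
  exact.
have n3 := near_bwd p'q (near_dom pq).
have [B [oB Bq] sB] := open_nbhs_sub (filterI n1 (filterI n2 n3)).
exists B => // k.
have H : Ck k B (fun y => (f \o bwd p) ((fwd p \o bwd p') y)).
  apply: (Ck_comp (phi := fwd p \o bwd p') oB _ _ (fU k)).
    by move=> y /sB [_ []].
  by apply: Ck_sub (tQ k) => y /sB[].
apply: (Ck_ext oB) H => y /sB [_ [_ yp]] /=.
by rewrite chart_fwdK.
Qed.

Lemma near_smooth_at p f : smooth_at p f -> \forall q \near p, smooth_at q f.
Proof.
move=> [U [oU Up] fU]; have pp := chart_at_dom p.
have n1 := near_fwd pp (open_nbhs_nbhs (conj oU Up)).
apply: filterS (filterI n1 (near_dom pp)) => q [Uq pq].
apply: smooth_in_change pq (chart_at_dom q) _; by exists U.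
Qed.

Lemma smooth_in_at p q f : dom p q -> smooth_in p q f -> smooth_at q f.
Proof. by move=> pq; apply: smooth_in_change pq (chart_at_dom q). Qed.

Lemma smooth_at_in p q f : dom p q -> smooth_at q f -> smooth_in p q f.
Proof. by move=> pq; apply: smooth_in_change (chart_at_dom q) pq. Qed.

Lemma smooth_at_near p f h : (\forall q \near p, f q = h q) ->
  smooth_at p f -> smooth_at p h.
Proof.
move=> fh [U [oU Up] fU]; have pp := chart_at_dom p.
have n1 := filterI (open_nbhs_nbhs (conj oU Up)) (near_bwd pp fh).
have [B [oB Bp] sB] := open_nbhs_sub (n1 _).
exists B => // k; have fB : Ck k B (f \o bwd p).
  by apply: Ck_sub (fU k) => y /sB[].
by apply: (Ck_ext oB) fB => y /sB[].
Qed.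

Lemma smooth_at_cst p (a : R) : smooth_at p (fun=> a).
Proof.
exists setT; first by split=> //; exact: openT.
by move=> k; apply: Ck_cst.
Qed.

Lemma smooth_atD p f h : smooth_at p f -> smooth_at p h ->
  smooth_at p (fun q => f q + h q).
Proof.
move=> [U [oU Up] fU] [V [oV Vp] hV].
have oI : open (U `&` V) by exact: openI.
exists (U `&` V) => // k.
apply: (CkD oI) (Ck_sub _ (fU k)) (Ck_sub _ (hV k)); by move=> ? [].
Qed.

Lemma smooth_atM p f h : smooth_at p f -> smooth_at p h ->
  smooth_at p (fun q => f q * h q).
Proof.
move=> [U [oU Up] fU] [V [oV Vp] hV].
have oI : open (U `&` V) by exact: openI.
exists (U `&` V) => // k.
apply: (CkM oI) (Ck_sub _ (fU k)) (Ck_sub _ (hV k)); by move=> ? [].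
Qed.

Lemma smooth_atZ p (a : R) f : smooth_at p f -> smooth_at p (fun q => a * f q).
Proof. by apply: smooth_atM; apply: smooth_at_cst. Qed.

Lemma smooth_atN p f : smooth_at p f -> smooth_at p (fun q => - f q).
Proof.
move=> /(smooth_atZ (-1)); apply: smooth_at_near.
by apply: nearW => q; rewrite mulN1r.
Qed.

Lemma smooth_atB p f h : smooth_at p f -> smooth_at p h ->
  smooth_at p (fun q => f q - h q).
Proof. by move=> sf sh; apply: smooth_atD => //; apply: smooth_atN. Qed.

Lemma smooth_at_sum p (I : Type) (r : seq I) (F : I -> M -> R) :
  (forall i, smooth_at p (F i)) -> smooth_at p (fun q => \sum_(i <- r) F i q).
Proof.
move=> FS; elim: r => [|i r IH].
  by apply: smooth_at_near (smooth_at_cst p 0); apply: nearW => q; rewrite big_nil.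
by apply: smooth_at_near (smooth_atD (FS i) IH); apply: nearW => q; rewrite big_cons.
Qed.

Lemma smooth_at_prod p (I : Type) (r : seq I) (F : I -> M -> R) :
  (forall i, smooth_at p (F i)) -> smooth_at p (fun q => \prod_(i <- r) F i q).
Proof.
move=> FS; elim: r => [|i r IH].
  by apply: smooth_at_near (smooth_at_cst p 1); apply: nearW => q; rewrite big_nil.
by apply: smooth_at_near (smooth_atM (FS i) IH); apply: nearW => q; rewrite big_cons.
Qed.

Lemma smooth_at_continuous p f : smooth_at p f -> f @ p --> f p.
Proof.
move=> [U [oU Up] fU]; have pp := chart_at_dom p.
have c1 : (f \o bwd p) @ fwd p p --> (f \o bwd p) (fwd p p) by exact: (fU 0%N).
rewrite /= chart_fwdK // in c1.
have c2 : (f \o bwd p \o fwd p) @ p --> f p.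
  by apply: cvg_comp c1; exact: chart_fwd_cont.
apply: cvg_trans c2; apply: near_eq_cvg.
by apply: filterS (near_dom pp) => q pq /=; rewrite chart_fwdK.
Qed.

Lemma near_neq0 p f : smooth_at p f -> f p != 0 -> \forall q \near p, f q != 0.
Proof.
move=> /smooth_at_continuous fc f0.
exact: (fc _ (open_nbhs_nbhs (conj (@open_neq _ 0) f0))).
Qed.

Lemma smooth_in_diff p q f : smooth_in p q f ->
  differentiable (f \o bwd p) (fwd p q).
Proof. by move=> [U [_ Up] fU]; have [+ _] := fU 1%N; apply. Qed.

Lemma smooth_at_diff p f : smooth_at p f -> differentiable (f \o bwd p) (fwd p p).
Proof. exact: smooth_in_diff. Qed.

Lemma transition_diff p p' q : dom p q -> dom p' q ->
  differentiable (fwd p' \o bwd p) (fwd p q).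
Proof.
by move=> pq p'q; have [U [_ Up] fU] := transition_smooth pq p'q;
  have [+ _] := fU 1%N; apply.
Qed.

(** * Rules for the derivative along a tangent vector *)

Lemma tderivDv p f x y : tderiv f p (x + y) = tderiv f p x + tderiv f p y.
Proof. by rewrite /tderiv linearD. Qed.

Lemma tderivZv p f a x : tderiv f p (a *: x) = a * tderiv f p x.
Proof. by rewrite /tderiv linearZ. Qed.

Lemma tderiv_sumv p f (I : Type) (r : seq I) (F : I -> 'rV[R]_n) :
  tderiv f p (\sum_(i <- r) F i) = \sum_(i <- r) tderiv f p (F i).
Proof. by rewrite /tderiv linear_sum. Qed.

Lemma tderiv_near p f h x : (\forall q \near p, f q = h q) -> smooth_at p f ->
  tderiv f p x = tderiv h p x.
Proof.
move=> fh sf; have nb := near_bwd (chart_at_dom p) fh.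
have [_ E] := near_eq_diff nb (smooth_at_diff sf).
exact: esym (congr1 (@^~ x) E).
Qed.

Lemma tderiv_cst p (a : R) x : tderiv (fun=> a : R) p x = 0.
Proof.
rewrite /tderiv; have -> : (fun=> a) \o bwd p = cst a by [].
by rewrite diff_cst.
Qed.

Lemma tderiv_ext p f h x : (forall q, f q = h q) -> tderiv f p x = tderiv h p x.
Proof. by move=> /funext ->. Qed.

Lemma tderivD p f h x : smooth_at p f -> smooth_at p h ->
  tderiv (fun q => f q + h q) p x = tderiv f p x + tderiv h p x.
Proof.
move=> /smooth_at_diff df /smooth_at_diff dh; exact: (congr1 (@^~ x) (diffD df dh)).
Qed.

Lemma tderivM p f h x : smooth_at p f -> smooth_at p h ->
  tderiv (fun q => f q * h q) p x = f p * tderiv h p x + h p * tderiv f p x.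
Proof.
move=> /smooth_at_diff df /smooth_at_diff dh.
have := congr1 (@^~ x) (diffM df dh).
by rewrite /= (chart_fwdK (chart_at_dom p)).
Qed.

Lemma tderivZ p (a : R) f x : smooth_at p f ->
  tderiv (fun q => a * f q) p x = a * tderiv f p x.
Proof.
by move=> sf; rewrite tderivM ?tderiv_cst ?mulr0 ?addr0 //; apply: smooth_at_cst.
Qed.

Lemma tderivN p f x : smooth_at p f ->
  tderiv (fun q => - f q) p x = - tderiv f p x.
Proof.
move=> sf; rewrite -mulN1r; apply: etrans (tderivZ (-1) x sf).
by apply: tderiv_ext => q; rewrite mulN1r.
Qed.

Lemma tderivB p f h x : smooth_at p f -> smooth_at p h ->
  tderiv (fun q => f q - h q) p x = tderiv f p x - tderiv h p x.
Proof. by move=> sf sh; rewrite tderivD ?tderivN //; apply: smooth_atN. Qed.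

Lemma tderiv_sum p (I : Type) (r : seq I) (F : I -> M -> R) x :
  (forall i, smooth_at p (F i)) ->
  tderiv (fun q => \sum_(i <- r) F i q) p x = \sum_(i <- r) tderiv (F i) p x.
Proof.
move=> FS; elim: r => [|i r IH].
  rewrite big_nil -[RHS](tderiv_cst p 0 x).
  by apply: tderiv_ext => q; rewrite big_nil.
rewrite big_cons -IH.
apply: etrans (tderivD x (FS i) (@smooth_at_sum p I r F FS)).
by apply: tderiv_ext => q; rewrite big_cons.
Qed.

Lemma smooth_at_sqrt p f : 0 < f p -> smooth_at p f ->
  smooth_at p (fun q => Num.sqrt (f q)).
Proof.
move=> f0 sf; have [U [oU Up] fU] := sf; have pp := chart_at_dom p.
have n2 := smooth_at_continuous sf (open_nbhs_nbhs (conj (@open_gt _ 0) f0)).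
have n1 := filterI (open_nbhs_nbhs (conj oU Up)) (near_bwd pp n2).
have [B [oB Bp] sB] := open_nbhs_sub (n1 _).
exists B => // k; apply: (@Ck_sqrt _ _ _ _ (f \o bwd p)) => //.
  by move=> y /sB[].
by apply: Ck_sub (fU k) => y /sB[].
Qed.

Lemma smooth_at_inv p f : f p != 0 -> smooth_at p f ->
  smooth_at p (fun q => (f q)^-1).
Proof.
move=> f0 sf; have [U [oU Up] fU] := sf; have pp := chart_at_dom p.
have n1 := filterI (open_nbhs_nbhs (conj oU Up)) (near_bwd pp (near_neq0 sf f0)).
have [B [oB Bp] sB] := open_nbhs_sub (n1 _).
exists B => // k; apply: (@Ck_inv _ _ _ _ (f \o bwd p)) => //.
  by move=> y /sB[].
by apply: Ck_sub (fU k) => y /sB[].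
Qed.

Lemma tderiv_sqrt p f x : 0 < f p -> smooth_at p f ->
  tderiv (fun q => Num.sqrt (f q)) p x = tderiv f p x / (Num.sqrt (f p) * 2).
Proof.
move=> f0 sf; have df := smooth_at_diff sf; have pp := chart_at_dom p.
have f0' : 0 < (f \o bwd p) (fwd p p) by rewrite /= chart_fwdK.
have [ds Ds] := diff_sqrt x f0' df.
rewrite /tderiv -[LHS](deriveE x ds) Ds (deriveE _ df).
by rewrite /= chart_fwdK.
Qed.

(** * Change of chart and coordinate fields *)

Lemma tderiv_change p q f x : dom p q -> smooth_at q f ->
  tderiv f q x = 'd (f \o bwd p) (fwd p q) ('d (fwd p \o bwd q) (fwd q q) x).
Proof.
move=> pq sf; have qq := chart_at_dom q.
apply: diff_comp_near; first by rewrite /= (chart_fwdK qq).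
- by apply: filterS (near_bwd qq (near_dom pq)) => y py /=; rewrite chart_fwdK.
- exact: transition_diff.
- exact: smooth_in_diff (smooth_at_in pq sf).
Qed.

(* The [i]-th coordinate field of the chart at [p], expressed at each [q] in the
   chart at [q]; it is meaningful on the domain of the chart at [p] only. *)
Definition coord_field p (i : 'I_n) : M -> 'rV[R]_n := fun q =>
  'd (fwd q \o bwd p) (fwd p q) (delta_mx 0 i).

(** The components of [coord_field p i q] come from the transition between the charts at [p] and
    [q]; the chain rule undoes this transition and leaves a plain partial derivative in the chart at
    [p]. *)
Lemma tderiv_coord_field p q i f : dom p q -> smooth_at q f ->
  tderiv f q (coord_field p i q) = 'D_(delta_mx 0 i) (f \o bwd p) (fwd p q).
Proof.
move=> pq sf; have qq := chart_at_dom q.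
rewrite (deriveE _ (smooth_in_diff (smooth_at_in pq sf))); apply: esym.
apply: diff_comp_near; first by rewrite /= (chart_fwdK pq).
- by apply: filterS (near_bwd pq (near_dom qq)) => y py /=; rewrite chart_fwdK.
- exact: transition_diff.
- exact: smooth_at_diff.
Qed.

Lemma coord_field_self p i : coord_field p i p = delta_mx 0 i.
Proof.
exact: diff_near_id (near_bwdK (chart_at_dom p)).
Qed.

Lemma smooth_at_coord p q j : dom p q -> smooth_at q (Defs.coord p j).
Proof.
move=> pq; apply: (smooth_in_at pq).
have [B [oB Bp] sB] := open_nbhs_sub (near_bwdK pq).
exists B => // k.
apply: (Ck_ext oB) (Ck_coord j oB (Ck_id k B)) => y /sB /= E.
by rewrite /Defs.coord E.
Qed.

Lemma tderiv_coord p j x : tderiv (Defs.coord p j) p x = x 0 j.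
Proof.
have pp := chart_at_dom p.
have [_ D] := diff_coord x j (transition_diff pp pp).
apply: etrans D _; congr (fun_of_matrix _ 0 j).
exact: diff_near_id (near_bwdK pp).
Qed.

Lemma tderiv_expand p q f x : dom p q -> smooth_at q f ->
  tderiv f q x =
  \sum_i tderiv (Defs.coord p i) q x * tderiv f q (coord_field p i q).
Proof.
move=> pq sf; apply: etrans (tderiv_change _ pq sf) _.
rewrite [X in 'd _ _ X]row_sum_delta linear_sum; apply: eq_bigr => i _.
rewrite linearZ /= -(deriveE _ (smooth_in_diff (smooth_at_in pq sf))).
rewrite -(tderiv_coord_field _ pq sf); congr (_ * _).
have [_ D] := diff_coord x i (transition_diff (chart_at_dom q) pq).
exact: esym D.
Qed.

Lemma coord_field_smooth p q i : dom p q -> vf_smooth_at q (coord_field p i).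
Proof.
move=> pq f sf; apply: (smooth_in_at pq).
have [U [oU Uq] fU] := smooth_at_in pq sf.
have n1 : \forall y \near fwd p q, smooth_at (bwd p y) f /\ dom p (bwd p y).
  exact: (near_bwd pq (filterI (near_smooth_at sf) (near_dom pq))).
have n2 := filterI (open_nbhs_nbhs (conj oU Uq)) (filterI n1 (near_bwdK pq)).
have [B [oB Bp] sB] := open_nbhs_sub (n2 _ _).
exists B => // k; have [_ /(_ i) DC] := fU k.+1.
have DB : Ck k B ('D_(delta_mx 0 i) (f \o bwd p)) by apply: Ck_sub DC => y /sB[].
apply: (Ck_ext oB) DB => y /sB [_ [[sy py] yK]].
by rewrite /= /act tderiv_coord_field //= yK.
Qed.

Lemma vf_smooth_near p X Y : (\forall q \near p, X q = Y q) ->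
  vf_smooth_at p X -> vf_smooth_at p Y.
Proof.
move=> XY sX f /sX; apply: smooth_at_near.
by apply: filterS XY => q; rewrite /act => ->.
Qed.

Lemma vf_smoothD p X Y : vf_smooth_at p X -> vf_smooth_at p Y ->
  vf_smooth_at p (fun q => X q + Y q).
Proof.
move=> sX sY f sf; apply: smooth_at_near (smooth_atD (sX f sf) (sY f sf)).
by apply: nearW => q; rewrite /act tderivDv.
Qed.

Lemma vf_smoothZ p f X : smooth_at p f -> vf_smooth_at p X ->
  vf_smooth_at p (fun q => f q *: X q).
Proof.
move=> sf sX h sh; apply: smooth_at_near (smooth_atM sf (sX h sh)).
by apply: nearW => q; rewrite /act tderivZv.
Qed.

Lemma vf_smooth0 p : vf_smooth_at p (fun=> 0).
Proof.
move=> f sf; apply: smooth_at_near (smooth_at_cst p 0).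
by apply: nearW => q; rewrite /act /tderiv linear0.
Qed.

Lemma vf_smooth_sum p (I : Type) (r : seq I) (F : I -> M -> 'rV[R]_n) :
  (forall i, vf_smooth_at p (F i)) ->
  vf_smooth_at p (fun q => \sum_(i <- r) F i q).
Proof.
move=> FS; elim: r => [|i r IH].
  apply: (@vf_smooth_near p (fun=> 0)); last exact: vf_smooth0.
  by apply: nearW => q; rewrite big_nil.
apply: (vf_smooth_near _ (vf_smoothD (FS i) IH)).
by apply: nearW => q; rewrite big_cons.
Qed.

(** * The bracket as a commutator of derivations *)

Lemma act_coord_field_comm p i j f : smooth_at p f ->
  act (coord_field p i) (act (coord_field p j) f) p =
  act (coord_field p j) (act (coord_field p i) f) p.
Proof.
move=> sf; have pp := chart_at_dom p; have [U [oU Up] fU] := sf.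
have sc k := coord_field_smooth k pp sf.
have E k : \forall y \near fwd p p, 'D_(delta_mx 0 k) (f \o bwd p) y =
     (act (coord_field p k) f \o bwd p) y.
  have n1 := filterI (near_smooth_at sf) (near_dom pp).
  apply: filterS (filterI (near_bwd pp (n1 _)) (near_bwdK pp)) => y [[sy py] yK].
  by rewrite /= /act tderiv_coord_field //= yK.
rewrite [LHS]/act [RHS]/act !tderiv_coord_field //.
rewrite -(near_eq_derive _ (E j)) -(near_eq_derive _ (E i)).
exact: derive_comm oU Up (fU 2%N).
Qed.

(** Differentiating Y f = sum_i Y(c_i) d_i f along X separates a first-order part, whose
    coefficients X(Y c_i) are those that define [bracket], from a second-order part that exchanging
    X and Y preserves. *)
Lemma act_act_expand p X Y f : vf_smooth_at p Y -> smooth_at p f ->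
  act X (act Y f) p =
  \sum_i act X (act Y (Defs.coord p i)) p * act (coord_field p i) f p +
  \sum_i \sum_j act Y (Defs.coord p i) p * act X (Defs.coord p j) p *
    act (coord_field p j) (act (coord_field p i) f) p.
Proof.
move=> sY sf; have pp := chart_at_dom p.
have sc i := smooth_at_coord i pp.
have sYc i := sY _ (sc i).
have sD i := coord_field_smooth i pp sf.
have E : \forall q \near p,
    \sum_i act Y (Defs.coord p i) q * act (coord_field p i) f q = act Y f q.
  apply: filterS (filterI (near_dom pp) (near_smooth_at sf)) => q [pq sfq].
  by rewrite [in RHS]/act (tderiv_expand _ pq sfq).
have sS : smooth_at p (fun q =>
    \sum_i act Y (Defs.coord p i) q * act (coord_field p i) f q).
  by apply: smooth_at_sum => i; apply: smooth_atM.
rewrite [LHS]/act -(tderiv_near _ E sS) tderiv_sum; last first.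
  by move=> i; apply: smooth_atM.
rewrite -big_split; apply: eq_bigr => i _ /=.
apply: etrans (tderivM _ (sYc i) (sD i)) _.
rewrite [LHS]addrC [in LHS](mulrC (act (coord_field p i) f p)).
congr (_ + _).
rewrite (tderiv_expand _ pp (sD i)) mulr_sumr; apply: eq_bigr => j _.
by rewrite mulrA.
Qed.

Lemma act_bracket p X Y f : vf_smooth_at p X -> vf_smooth_at p Y ->
  smooth_at p f ->
  act (bracket X Y) f p = act X (act Y f) p - act Y (act X f) p.
Proof.
move=> sX sY sf; have pp := chart_at_dom p.
rewrite (act_act_expand X sY sf) (act_act_expand Y sX sf).
(* Renaming the indices of the second double sum lines it up with the first, up to the order of the
   two coordinate fields. *)
rewrite [X in _ = _ - (_ + X)]exchange_big /=.
rewrite [in X in _ = _ - (_ + X)](eq_bigr (fun i => \sum_j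
  act Y (Defs.coord p i) p * act X (Defs.coord p j) p *
    act (coord_field p j) (act (coord_field p i) f) p)); last first.
  move=> i _; apply: eq_bigr => j _.
  by rewrite act_coord_field_comm // (mulrC (act X _ _)).
rewrite opprD addrACA subrr addr0 -sumrB [LHS]/act (tderiv_expand _ pp sf).
apply: eq_bigr => i _; rewrite tderiv_coord mxE -mulrBl.
by [].
Qed.

Lemma bracket_smooth X Y : vector_field X -> vector_field Y ->
  vector_field (bracket X Y).
Proof.
move=> sX sY p f sf.
apply: smooth_at_near (smooth_atB (sX p _ (sY p _ sf)) (sY p _ (sX p _ sf))).
apply: filterS (near_smooth_at sf) => q sfq.
by rewrite act_bracket.
Qed.

Lemma act_bracketr p X Y Z f : vf_smooth_at p X -> vector_field Y ->
  vector_field Z -> smooth_at p f ->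
  act X (act (bracket Y Z) f) p =
  act X (act Y (act Z f)) p - act X (act Z (act Y f)) p.
Proof.
move=> sX sY sZ sf.
have s1 := sY p _ (sZ p _ sf); have s2 := sZ p _ (sY p _ sf).
apply: etrans (tderivB (X p) s1 s2); apply/esym/tderiv_near; last exact: smooth_atB.
by apply: filterS (near_smooth_at sf) => q sfq; rewrite act_bracket.
Qed.

(** Tested on a coordinate function, the cyclic sum becomes twelve third-order terms: each of the
    six orders of X, Y, Z occurs twice, with opposite signs. *)
Lemma bracket_jacobi p X Y Z : vector_field X -> vector_field Y ->
  vector_field Z ->
  bracket X (bracket Y Z) p + bracket Y (bracket Z X) p +
  bracket Z (bracket X Y) p = 0.
Proof.
move=> sX sY sZ; apply/rowP => j; rewrite [RHS]mxE -(tderiv_coord p j) !tderivDv.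
have sc := smooth_at_coord j (chart_at_dom p).
have b (A B : M -> 'rV[R]_n) : vector_field A -> vector_field B -> vector_field (bracket A B).
  exact: bracket_smooth.
set c := Defs.coord p j.
rewrite -[tderiv c p (bracket X _ p)]/(act (bracket X (bracket Y Z)) c p).
rewrite -[tderiv c p (bracket Y _ p)]/(act (bracket Y (bracket Z X)) c p).
rewrite -[tderiv c p (bracket Z _ p)]/(act (bracket Z (bracket X Y)) c p).
rewrite !act_bracket //; try by [apply: b | apply: sX | apply: sY | apply: sZ].
rewrite !act_bracketr //; do 6! move: (act _ _ p) => ?; ring.
Qed.

End Manifold.

(** * Symmetric bilinear forms *)

Section BilinearForm.
Context (R : realType) (E : vectType R) (b : E -> E -> R).
Hypothesis b_linear : forall a x y z, b (a *: x + y) z = a * b x z + b y z.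
Hypothesis b_sym : forall x y, b x y = b y x.

Lemma form0l x : b 0 x = 0.
Proof.
have := b_linear (-1) 0 0 x; rewrite scaler0 addr0 mulN1r => ->.
by rewrite addNr.
Qed.

Lemma formDl x y z : b (x + y) z = b x z + b y z.
Proof. by rewrite -{1}[x]scale1r b_linear mul1r. Qed.

Lemma formZl a x z : b (a *: x) z = a * b x z.
Proof. by rewrite -[a *: x]addr0 b_linear form0l addr0. Qed.

Lemma form_suml (I : Type) (r : seq I) (F : I -> E) z :
  b (\sum_(i <- r) F i) z = \sum_(i <- r) b (F i) z.
Proof.
by elim: r => [|i r IH]; rewrite ?big_nil ?form0l // !big_cons formDl IH.
Qed.

Definition ortho_seq (s : seq E) :=
  (forall i j, (i < size s)%N -> (j < size s)%N -> i != j ->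
     b (nth 0 s i) (nth 0 s j) = 0) /\
  (forall x, x \in s -> b x x = 1 \/ b x x = - 1).

Lemma form_linear x : linear (b x : E -> R^o).
Proof. by move=> a y z /=; rewrite ![b x _]b_sym b_linear. Qed.

Lemma mem_lker_linfun (f : E -> R^o) (fl : linear f) x :
  (x \in lker (linfun f)) = (f x == 0).
Proof.
pose fL : {linear E -> R^o} := HB.pack f (GRing.isLinear.Build _ _ _ _ f fl).
by rewrite memv_ker -[f]/(fL : E -> R^o) lfunE.
Qed.

(** Gram-Schmidt for an indefinite form cannot start from an arbitrary vector. Polarisation gives a
    non-null one: if b x x vanished on [U], then 2 b x y would too, against nondegeneracy. Once
    normalised it is split off, and induction runs on its orthogonal in [U]. *)
Lemma ortho_basis_exists (U : {vspace E}) :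
  (forall x, x \in U -> (forall y, y \in U -> b x y = 0) -> x = 0) ->
  exists2 s, basis_of U s & ortho_seq s.
Proof.
have [m] := ubnP (\dim U); elim: m U => // m IH U; rewrite ltnS => dU nd.
have [U0|U0] := eqVneq U 0%VS.
  exists [::]; last by split.
  by rewrite /basis_of span_nil U0 eqxx nil_free.
have [w [wU w0]] : exists w, w \in U /\ b w w != 0.
  apply: contrapT => H.
  have q0 x : x \in U -> b x x = 0.
    by move=> xU; apply/eqP/negPn/negP => bx; apply: H; exists x.
  have /eqP := U0; apply; apply/eqP; rewrite -subv0; apply/subvP => x xU.
  rewrite memv0; apply/eqP/nd => // y yU.
  have := q0 _ (memvD xU yU); rewrite formDl ![b _ (x + y)]b_sym !formDl.
  rewrite (q0 _ xU) (q0 _ yU) (b_sym y x) add0r addr0 -mulr2n => /eqP.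
  by rewrite mulrn_eq0 => /eqP.
pose v := (Num.sqrt `|b w w|)^-1 *: w.
have vU : v \in U by exact: memvZ.
have bv : b v v = 1 \/ b v v = -1.
  have s0 : 0 < `|b w w| by rewrite normr_gt0.
  rewrite /v formZl b_sym formZl mulrA -invfM -expr2 sqr_sqrtr ?ltW //.
  have [bw|bw] := ltrP (b w w) 0; [right|left].
    by rewrite ltr0_norm // invrN mulNr mulVf.
  by rewrite ger0_norm // mulVf.
have bv0 : b v v != 0 by case: bv => ->; rewrite ?oppr_eq0 oner_eq0.
pose U' := (U :&: lker (linfun (b v : E -> R^o)))%VS.
have U'P x : (x \in U') = (x \in U) && (b v x == 0).
  by rewrite memv_cap (mem_lker_linfun (form_linear v)).
have vU' : v \notin U' by rewrite U'P (negbTE bv0) andbF.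
have sU : (U' <= U)%VS by exact: capvSl.
have dec x : x \in U -> x - (b v x / b v v) *: v \in U'.
  move=> xU; rewrite U'P memvB ?memvZ //= b_sym formDl -scaleNr formZl.
  by rewrite mulNr divfK // b_sym subrr.
have dU' : (\dim U' < m)%N.
  apply: leq_trans dU; rewrite ltn_neqAle (dimvS sU) andbT.
  apply: contraNneq vU' => e.
  by have := eqEdim U' U; rewrite sU e leqnn => /eqP ->.
have [|s' bs' [so1 so2]] := IH U' dU'.
  (* Nondegeneracy passes to [U']: each [y] in [U] is a multiple of [v] plus an element of [U'], and
     [x] is orthogonal to both. *)
  move=> x; rewrite U'P => /andP[xU vx] H; apply: nd => // y yU.
  rewrite -[y](subrK ((b v y / b v v) *: v)) b_sym formDl b_sym H ?dec //.
  by rewrite formZl (eqP vx) mulr0 addr0.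
have ms' x : x \in s' -> b v x = 0.
  move=> xs; have : x \in U' by apply: (basis_mem bs').
  by rewrite U'P => /andP[_ /eqP].
exists (v :: s').
  have /andP[/eqP sp fr] := bs'.
  rewrite /basis_of span_cons free_cons sp vU' fr !andbT eqEsubv; apply/andP; split.
    by rewrite subv_add sU andbT -memvE.
  apply/subvP => x xU; rewrite -[x](subrK ((b v x / b v v) *: v)) addrC.
  by apply: memv_add; [rewrite memvZ // memv_line | exact: dec].
split=> [[|i] [|j] //= il jl ij|x].
- by apply/ms'/mem_nth.
- by rewrite b_sym; apply/ms'/mem_nth.
- exact: so1.
- by rewrite inE => /predU1P[->|/so2].
Qed.

Lemma codom_nth (T : Type) (x0 : T) (m : nat) (s : seq T) : size s = m ->
  codom (fun i : 'I_m => nth x0 s i) = s.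
Proof.
move=> sm; rewrite codomE; apply: (@eq_from_nth _ x0).
  by rewrite size_map size_enum_ord.
move=> i; rewrite size_map size_enum_ord => im.
by rewrite (nth_map (Ordinal im)) ?size_enum_ord // nth_enum_ord.
Qed.

Lemma span_codomP (m : nat) (e : 'I_m -> E) x : x \in <<codom e>>%VS ->
  exists c : 'I_m -> R, x = \sum_i c i *: e i.
Proof.
have -> : codom e = [tuple e i | i < m] by rewrite codomE.
move=> /coord_span xe; exists (fun i => coord [tuple e i | i < m] i x).
by rewrite {1}xe; apply: eq_bigr => i _; rewrite nth_mktuple.
Qed.

(** Weights replace normalisation: an orthonormal basis enters with its signs as weights, and a
    non-null vector v of any length may enter with weight 1 / b v v. *)
Definition form_expansion (s : seq (R * E)) (U : {vspace E}) := forall x, x \in U ->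
  x = \sum_(i <- s) (i.1 * b x i.2) *: i.2.

Lemma ortho_expansion (U : {vspace E}) (m : nat) (e : 'I_m -> E) :
  basis_of U (codom e) -> (forall i j, i != j -> b (e i) (e j) = 0) ->
  (forall i, b (e i) (e i) = 1 \/ b (e i) (e i) = - 1) ->
  forall x, x \in U -> x = \sum_i (b (e i) (e i) * b x (e i)) *: e i.
Proof.
move=> /andP[/eqP <- _] eo e1 x /span_codomP[c ->].
apply: eq_bigr => i _; congr (_ *: _).
rewrite form_suml (bigD1 i) //= big1 ?addr0 => [|j ji]; last by rewrite formZl eo ?mulr0.
by rewrite formZl; case: (e1 i) => ->; rewrite ?mulrN1 ?mulN1r ?mul1r ?mulr1 ?opprK.
Qed.

(** Expanding one argument of [S] in the other family turns both sides into the same double sum of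
    w_i w_j b(s_i, t_j) S(s_i, t_j), with w the weights. *)
Lemma trace_invariant (s t : seq (R * E)) (S : E -> E -> R) :
  (forall a x y z, S (a *: x + y) z = a * S x z + S y z) ->
  (forall a x y z, S z (a *: x + y) = a * S z x + S z y) ->
  form_expansion s fullv -> form_expansion t fullv ->
  \sum_(i <- s) i.1 * S i.2 i.2 = \sum_(j <- t) j.1 * S j.2 j.2.
Proof.
move=> Sl Sr es et.
have S0l x : S 0 x = 0.
  by have := Sl (-1) 0 0 x; rewrite scaler0 addr0 mulN1r => ->; rewrite addNr.
have S0r x : S x 0 = 0.
  by have := Sr (-1) 0 0 x; rewrite scaler0 addr0 mulN1r => ->; rewrite addNr.
have Suml (r : seq (R * E)) (c : R * E -> R) z :
    S (\sum_(i <- r) c i *: i.2) z = \sum_(i <- r) c i * S i.2 z.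
  by elim: r => [|i r IH]; rewrite ?big_nil ?S0l // !big_cons Sl IH.
have Sumr (r : seq (R * E)) (c : R * E -> R) z :
    S z (\sum_(i <- r) c i *: i.2) = \sum_(i <- r) c i * S z i.2.
  by elim: r => [|i r IH]; rewrite ?big_nil ?S0r // !big_cons Sr IH.
under eq_bigr => i _ do rewrite [X in S _ X](et _ (memvf _)) Sumr mulr_sumr.
rewrite exchange_big; apply: eq_bigr => j _.
rewrite [X in S X _](es _ (memvf _)) Suml mulr_sumr; apply: eq_bigr => i _.
rewrite b_sym; ring.
Qed.

(** * Pointwise algebra of torsion and curvature *)

Lemma formDr z x y : b z (x + y) = b z x + b z y.
Proof. by rewrite b_sym formDl !(b_sym z). Qed.

Lemma formZr a z x : b z (a *: x) = a * b z x.
Proof. by rewrite b_sym formZl b_sym. Qed.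

Lemma formNl x z : b (- x) z = - b x z.
Proof. by rewrite -scaleN1r formZl mulN1r. Qed.

Lemma formNr x z : b z (- x) = - b z x.
Proof. by rewrite b_sym formNl b_sym. Qed.

(* [torsion_term v a c] is [nablaV_a c - nabla_a c]; [dtorsion_term] is its
   covariant derivative when [da], [dc], [dv] are those of [a], [c], [v]. *)
Definition torsion_term (v a c : E) : E := b a c *: v - b v c *: a.

Definition dtorsion_term (v a c da dc dv : E) : E :=
  ((b da c + b a dc) *: v + b a c *: dv)
  - ((b dv c + b v dc) *: a + b v c *: da).

(** [xv] and [yv] stand for nabla_x V and nabla_y V. With A = S + V^b V^b - g(V, V) g / 2 the
    formula reads g(y,z) A(x,w) + A(y,z) g(x,w) - A(x,z) g(y,w) - g(x,z) A(y,w), a Kulkarni-Nomizu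
    product of g and A. A symmetric A makes it pair symmetric, and its trace over y = z is (n - 2) A
    + (tr A) g. *)
Definition curvature_defect (v x y z w xv yv : E) : R :=
  b y z * b xv w - b xv z * b y w - b x z * b yv w + b yv z * b x w
  + b y z * b v x * b v w - b x z * b v y * b v w
  - b v v * (b y z * b x w - b x z * b y w)
  + b v z * b v y * b x w - b v z * b v x * b y w.

(** [xy] stands for nabla_X Y, similarly [yx], [xz], [yz], and [xy - yx] for the bracket. All four
    drop out on the right: the difference of the curvatures is tensorial. *)
Lemma curvature_defectE (v x y z w xv yv xy yx xz yz : E) :
  b ((dtorsion_term v y z xy xz xv + torsion_term v x (yz + torsion_term v y z))
     - (dtorsion_term v x z yx yz yv + torsion_term v y (xz + torsion_term v x z))
     - torsion_term v (xy - yx) z) w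
  = curvature_defect v x y z w xv yv.
Proof.
rewrite /dtorsion_term /torsion_term /curvature_defect.
rewrite !(formDl, formNl, formZl, formDr, formNr, formZr).
rewrite (b_sym y x) (b_sym x v) (b_sym y v).
do ! move: (b _ _) => ?; ring.
Qed.

Lemma curvature_defect_pair (v x y z w xv yv zv wv : E) :
  b xv z = b zv x -> b xv w = b wv x -> b yv z = b zv y -> b yv w = b wv y ->
  curvature_defect v x y z w xv yv = curvature_defect v z w x y zv wv.
Proof.
rewrite /curvature_defect => -> -> -> ->.
rewrite (b_sym z x) (b_sym z y) (b_sym w x) (b_sym w y).
do ! move: (b _ _) => ?; ring.
Qed.

(** [D] plays the part of u |-> nabla_u V. Every contraction over the basis is of type b u e_i * b
    e_i u', or the same with D applied to e_i, or a sum of squared signs equal to [m], or the trace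
    of [D], which is kept. *)
Lemma curvature_defect_trace (m : nat) (e : 'I_m -> E) (v x w : E) (D : E -> E) :
  (forall u, u = \sum_i (b (e i) (e i) * b u (e i)) *: e i) ->
  (forall i, b (e i) (e i) = 1 \/ b (e i) (e i) = - 1) ->
  (forall a u u', D (a *: u + u') = a *: D u + D u') ->
  \sum_i b (e i) (e i) * curvature_defect v x (e i) (e i) w (D x) (D (e i))
  = (m%:R - 2) * b (D x) w
    + (\sum_i b (e i) (e i) * b (D (e i)) (e i) + (2 - m%:R) * b v v) * b x w
    + (m%:R - 2) * b v x * b v w.
Proof.
move=> ex e1 Dl.
have D0 : D 0 = 0.
  by have := Dl (-1) 0 0; rewrite scaler0 addr0 scaleN1r addNr.
have Dsum (c : 'I_m -> R) : D (\sum_i c i *: e i) = \sum_i c i *: D (e i).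
  elim/big_ind2 : _ => // [u u' a a' <- <-|i _].
    by rewrite -[u']scale1r Dl !scale1r.
  by rewrite -[c i *: e i]addr0 Dl D0 addr0.
have P u u' : \sum_i b (e i) (e i) * (b u (e i) * b (e i) u') = b u u'.
  rewrite [in RHS](ex u) form_suml; apply: eq_bigr => i _.
  by rewrite formZl mulrA.
have PD u : \sum_i b (e i) (e i) * (b u (e i) * b (D (e i)) w) = b (D u) w.
  rewrite [in RHS](ex u) Dsum form_suml; apply: eq_bigr => i _.
  by rewrite formZl mulrA.
have P1 : \sum_i b (e i) (e i) * b (e i) (e i) = m%:R.
  transitivity (\sum_(i < m) (1 : R)); last by rewrite sumr_const card_ord.
  by apply: eq_bigr => i _; case: (e1 i) => ->; rewrite ?mulrNN mulr1.
transitivity (\sum_i (b (e i) (e i) * b (e i) (e i) *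
    (b (D x) w + b v x * b v w - b v v * b x w)
  - b (e i) (e i) * (b (D x) (e i) * b (e i) w)
  - b (e i) (e i) * (b x (e i) * b (D (e i)) w)
  + b (e i) (e i) * b (D (e i)) (e i) * b x w
  - b (e i) (e i) * (b x (e i) * b (e i) v) * b v w
  + b (e i) (e i) * (b x (e i) * b (e i) w) * b v v
  + b (e i) (e i) * (b v (e i) * b (e i) v) * b x w
  - b (e i) (e i) * (b v (e i) * b (e i) w) * b v x)).
  apply: eq_bigr => i _; rewrite /curvature_defect (b_sym (e i) v).
  do ! move: (b _ _) => ?; ring.
rewrite !(big_split, sumrN) /= -!mulr_suml !P PD P1 (b_sym x v).
move: (\sum_i _) => ?; do ! move: (b _ _) => ?; ring.
Qed.

End BilinearForm.

(** The cyclic identity is taken at the four rotations of (x, y, z, w); the antisymmetries reduce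
    their terms to common representatives, and a linear combination remains. [T] will be the type of
    smooth vector fields. *)
Lemma curvature_pair_symmetry (R : realFieldType) (T : Type) (r : T -> T -> T -> T -> R) :
  (forall x y z w, r x y z w = - r y x z w) ->
  (forall x y z w, r x y z w = - r x y w z) ->
  (forall x y z w, r x y z w + r y z x w + r z x y w = 0) ->
  forall x y z w, r x y z w = r z w x y.
Proof.
move=> r1 r2 r3 x y z w.
have H1 := r3 x y z w; have H2 := r3 y z w x; have H3 := r3 z w x y.
have H4 := r3 w x y z.
rewrite (r1 z x y w) in H1.
rewrite (r2 y z w x) (r2 z w y x) (r1 w y z x) (r2 y w z x) in H2.
rewrite (r1 w x z y) (r2 x w z y) (r2 x z w y) in H3.
rewrite (r1 w x y z) (r2 x y w z) in H4.
move: H1 H2 H3 H4; do ! move: (r _ _ _ _) => ?; lra.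
Qed.

(** * Metrics and connections *)

Section Geometry.
Context (R : realType) (n : nat) (M : smooth_manifold R n).
Context (g : semi_riemannian_metric M).
Implicit Types (p q : M) (f h : M -> R) (V X Y Z W : M -> 'rV[R]_n) (x y : 'rV[R]_n).

Let glin p := metric_linear g p.
Let gsym p := Defs.metric_sym g p.
Let gDl p := formDl (glin p).
Let gDr p := formDr (glin p) (gsym p).
Let gZl p := formZl (glin p).
Let gZr p := formZr (glin p) (gsym p).
Let gNl p := formNl (glin p).
Let gNr p := formNr (glin p) (gsym p).

Lemma smooth_inner p X Y : vf_smooth_at p X -> vf_smooth_at p Y ->
  smooth_at p (inner g X Y).
Proof. exact: metric_smooth. Qed.

(** * The hyperplanes orthogonal to V *)

Lemma mem_perp V p x : (x \in perp g V p) = (g p (V p) x == 0).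
Proof. exact: mem_lker_linfun (form_linear (glin p) (gsym p) (V p)) x. Qed.

(** Turns a tangent vector into a field smooth around [p], so that pointwise claims can be tested
    with hypotheses about fields. *)
Definition const_extension p x : M -> 'rV[R]_n := fun q => \sum_j x 0 j *: coord_field p j q.

Lemma const_extension_smooth p x : vf_smooth_at p (const_extension p x).
Proof.
apply: vf_smooth_sum => j; apply: vf_smoothZ; first exact: smooth_at_cst.
exact: coord_field_smooth (chart_at_dom p).
Qed.

Lemma const_extension_self p x : const_extension p x p = x.
Proof.
rewrite [RHS]row_sum_delta; apply: eq_bigr => j _.
by rewrite coord_field_self.
Qed.

(** Orthogonal projection along V, applied at every point: it makes extensions of tangent vectors of
    V^perp into sections of V^perp. *)
Definition perp_proj V X : M -> 'rV[R]_n := fun q =>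
  X q + (- (inner g V X q / inner g V V q)) *: V q.

Lemma perp_proj_perp V X p : inner g V V p != 0 -> g p (V p) (perp_proj V X p) = 0.
Proof.
by move=> V0; rewrite /perp_proj gDr gZr mulNr divfK ?subrr.
Qed.

Lemma perp_proj_id V X p : g p (V p) (X p) = 0 -> perp_proj V X p = X p.
Proof. by move=> E; rewrite /perp_proj /inner E mul0r oppr0 scale0r addr0. Qed.

Lemma perp_proj_smooth V X p : inner g V V p != 0 -> vf_smooth_at p V ->
  vf_smooth_at p X -> vf_smooth_at p (perp_proj V X).
Proof.
move=> V0 sV sX; apply: vf_smoothD => //; apply: vf_smoothZ => //.
apply: smooth_atN; apply: smooth_atM; first exact: smooth_inner.
by apply: smooth_at_inv => //; apply: smooth_inner.
Qed.

Lemma dim_perp V p : inner g V V p != 0 -> \dim (perp g V p) = n.-1.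
Proof.
move=> V0; pose fl := form_linear (glin p) (gsym p) (V p).
pose fL : {linear 'rV[R]_n -> R^o} :=
  HB.pack (g p (V p) : _ -> R^o) (GRing.isLinear.Build _ _ _ _ _ fl).
have := limg_ker_dim (linfun fL) fullv.
rewrite capfv -[lker _]/(perp g V p) dimvf.
have -> : \dim (limg (linfun fL)) = 1%N.
  apply/eqP; rewrite eqn_leq; apply/andP; split.
    by apply: leq_trans (dimvS (subvf _)) _; rewrite dimvf.
  rewrite lt0n dimv_eq0; apply: contraNneq V0 => E.
  have : linfun fL (V p) \in limg (linfun fL) by rewrite memv_img ?memvf.
  by rewrite E memv0 lfunE.
by rewrite addn1 => /(congr1 predn) /= ->; rewrite /dim /= mul1n.
Qed.

(* The matrix of the [F i] against functions [h l] whose differentials at [p]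
   are dual to the [F i p] has determinant [1] at [p]. *)
Lemma near_free p (k : nat) (F : 'I_k -> M -> 'rV[R]_n) :
  (forall i, vf_smooth_at p (F i)) -> free (codom (fun i => F i p)) ->
  \forall q \near p, free (codom (fun i => F i q)).
Proof.
have cE q : codom (fun i => F i q) = [tuple F i q | i < k] by rewrite codomE.
move=> sF; rewrite cE => Fp; set t := [tuple F i p | i < k] in Fp.
pose h l q := \sum_j vector.coord t l (delta_mx 0 j) * Defs.coord p j q.
have sh l : smooth_at p (h l).
  apply: smooth_at_sum => j; apply: smooth_atZ.
  exact: smooth_at_coord (chart_at_dom p).
have hx l x : tderiv (h l) p x = vector.coord t l x.
  rewrite tderiv_sum => [|j]; last first.
    by apply: smooth_atZ; apply: smooth_at_coord (chart_at_dom p).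
  rewrite [in RHS](row_sum_delta x) linear_sum; apply: eq_bigr => j _.
  rewrite tderivZ ?tderiv_coord ?linearZ /= 1?mulrC //.
  exact: smooth_at_coord (chart_at_dom p).
pose A q : 'M[R]_k := \matrix_(i, l) act (F i) (h l) q.
have sA : smooth_at p (fun q => \det (A q)).
  apply: smooth_at_sum => s; apply: smooth_atZ; apply: smooth_at_prod => i.
  apply: (smooth_at_near _ (sF i _ (sh _))); apply: nearW => q.
  by rewrite mxE.
have A1 : \det (A p) != 0.
  have -> : A p = 1%:M.
    apply/matrixP => i l; rewrite !mxE /act hx.
    have -> : F i p = t`_i by rewrite nth_mktuple.
    by rewrite coord_free // eq_sym.
  by rewrite det1 oner_eq0.
apply: filterS (near_neq0 sA A1) => q Aq; rewrite cE.
apply/freeP => c c0 i.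
(* A linear relation between the [F j q], applied to each [h l], says that the invertible matrix
   [A q] kills the row of coefficients. *)
have /rowP/(_ i) : (\row_i c i) = 0 :> 'rV[R]_k.
  have Au : A q \in unitmx by rewrite unitmxE unitfE.
  rewrite -[LHS](mulmxK Au) (_ : _ *m A q = 0) ?mul0mx //.
  apply/rowP => l; rewrite !mxE.
  have : tderiv (h l) q (\sum_i c i *: F i q) = 0.
    rewrite (_ : \sum_i _ = 0) ?[LHS]linear0 //.
    by rewrite -[RHS]c0; apply: eq_bigr => j _; rewrite nth_mktuple.
  rewrite tderiv_sumv => h0; apply: etrans h0; apply: eq_bigr => j _.
  by rewrite !mxE tderivZv.
by rewrite !mxE.
Qed.

(** A basis of the hyperplane at [p] is extended and projected back into V^perp. The extension stays
    free near [p], and by dimension it spans. *)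
Lemma perp_distribution V : vector_field V -> (forall p, inner g V V p != 0) ->
  is_distribution n.-1 (perp g V).
Proof.
move=> sV V0; split=> [p|p]; first exact: dim_perp.
have dp := dim_perp (V0 p).
have [s bs ss] : exists2 s : seq 'rV[R]_n, basis_of (perp g V p) s & size s = n.-1.
  exists (vbasis (perp g V p)); first exact: vbasisP.
  by rewrite size_tuple dp.
pose F (i : 'I_n.-1) := perp_proj V (const_extension p s`_i).
have sF i : vf_smooth_at p (F i) by apply: perp_proj_smooth => //; apply: const_extension_smooth.
have Fp : codom (fun i => F i p) = s.
  rewrite -[RHS](codom_nth 0 ss); apply: eq_codom => i.
  rewrite /F perp_proj_id const_extension_self //; apply/eqP; rewrite -mem_perp.
  by apply: (basis_mem bs); apply: mem_nth; rewrite ss.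
exists F; split=> //.
have nf : \forall q \near p, free (codom (fun i => F i q)).
  by apply: near_free => //; rewrite Fp; case/andP: bs.
apply: filterS nf => q fq; apply/esym/eqP; rewrite eqEdim; apply/andP; split.
  apply/span_subvP => _ /codomP[i ->]; rewrite mem_perp.
  by apply/eqP/perp_proj_perp.
by rewrite (eqP fq) size_codom card_ord dim_perp.
Qed.

Lemma inner_near0 V p X : (\forall q \near p, X q \in perp g V q) -> forall x,
  tderiv (fun q => flat g V q (X q)) p x = 0.
Proof.
move=> XD x; rewrite -[RHS](tderiv_cst p 0 x).
apply/esym/tderiv_near; last exact: smooth_at_cst.
by apply: filterS XD => q; rewrite mem_perp => /eqP.
Qed.

(** On sections of V^perp both derivative terms of dV^b(X, Y) vanish, which leaves -g(V, [X, Y]). *)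
Lemma perp_involutive V :
  (forall p X Y, vf_smooth_at p X -> vf_smooth_at p Y ->
     dform (flat g V) X Y p = 0) -> is_involutive (perp g V).
Proof.
move=> dV p X Y [sX XD] [sY YD]; have := dV p X Y sX sY.
rewrite /dform /act !inner_near0 // subrr sub0r => /eqP.
by rewrite oppr_eq0 mem_perp.
Qed.

Lemma act_perp_inner V X : vector_field V -> vector_field X ->
  (forall p X Y, vf_smooth_at p X -> vf_smooth_at p Y ->
     dform (flat g V) X Y p = 0) ->
  (forall p, X p \in perp g V p) ->
  forall p, act X (inner g V V) p = inner g V (bracket X V) p.
Proof.
move=> sV sX dV XD p; have := dV p X V (sX p) (sV p).
rewrite /dform {2}/act inner_near0; last exact: nearW.
by rewrite subr0 => /eqP; rewrite subr_eq0 => /eqP.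
Qed.

(** * The length of V *)

Lemma smooth_near_sg p f : f p != 0 -> smooth_at p f ->
  \forall q \near p, `|f q| = Num.sg (f p) * f q.
Proof.
move=> f0 sf; have fc := smooth_at_continuous sf.
have [fp|fp] := ltrP (f p) 0.
  have fn : \forall q \near p, f q < 0.
    exact: (fc _ (open_nbhs_nbhs (conj (@open_lt _ 0) fp))).
  by apply: filterS fn => q fq; rewrite (ltr0_sg fp) mulN1r ltr0_norm.
have {}fp : 0 < f p by rewrite lt_neqAle eq_sym f0.
have fn : \forall q \near p, 0 < f q.
  exact: (fc _ (open_nbhs_nbhs (conj (@open_gt _ 0) fp))).
by apply: filterS fn => q fq; rewrite (gtr0_sg fp) mul1r gtr0_norm.
Qed.

Lemma vnorm_gt0 V p : inner g V V p != 0 -> 0 < vnorm g V p.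
Proof. by move=> V0; rewrite sqrtr_gt0 normr_gt0. Qed.

Lemma smooth_abs p f : f p != 0 -> smooth_at p f -> smooth_at p (fun q => `|f q|).
Proof.
move=> f0 sf; apply: (smooth_at_near (f := fun q => Num.sg (f p) * f q)).
  by apply: filterS (smooth_near_sg f0 sf) => q ->.
exact: smooth_atZ.
Qed.

Lemma smooth_vnorm V p : inner g V V p != 0 -> vf_smooth_at p V ->
  smooth_at p (vnorm g V).
Proof.
move=> V0 sV; apply: (@smooth_at_sqrt _ _ _ p (fun q => `|inner g V V q|)).
  by rewrite normr_gt0.
by apply: smooth_abs => //; apply: smooth_inner.
Qed.

(** A logarithmic derivative: |V|^2 is g(V, V) up to a locally constant sign, which cancels in the
    quotient, so one formula serves both causal characters of V. *)
Lemma tderiv_vnorm V p x : inner g V V p != 0 -> vf_smooth_at p V ->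
  (vnorm g V p)^-1 * tderiv (vnorm g V) p x =
  tderiv (inner g V V) p x / (2 * inner g V V p).
Proof.
move=> V0 sV; have sc := smooth_inner sV sV; set c := inner g V V in V0 sc *.
have sa := smooth_abs V0 sc.
have a0 : 0 < `|c p| by rewrite normr_gt0.
rewrite (tderiv_sqrt x a0 sa) -(tderiv_near _ _ (smooth_atZ (Num.sg (c p)) sc)); last first.
  by apply: filterS (smooth_near_sg V0 sc) => q ->.
rewrite (tderivZ _ _ sc) /vnorm -/c.
have s0 : Num.sqrt `|c p| != 0 by rewrite gt_eqF // sqrtr_gt0.
set v := Num.sqrt _ in s0 *; set t := tderiv c p x.
have vv : v * v = Num.sg (c p) * c p by rewrite -expr2 sqr_sqrtr ?ltW // normrEsg.
have sg0 : Num.sg (c p) != 0 by rewrite sgr_eq0.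
transitivity (Num.sg (c p) * t / (v * v * 2)); first by field.
by rewrite vv; field; rewrite V0 sg0.
Qed.

(** * Curvature of the two connections *)

Section Connection.
Variable nabla : (M -> 'rV[R]_n) -> M -> 'rV[R]_n -> 'rV[R]_n.
Hypothesis LC : is_levi_civita g nabla.

Let conn := levi_civita_connection LC.

Lemma nabla_metric p x Y Z : vf_smooth_at p Y -> vf_smooth_at p Z ->
  tderiv (inner g Y Z) p x = g p (nabla Y p x) (Z p) + g p (Y p) (nabla Z p x).
Proof. exact: levi_civita_metric. Qed.

Lemma nabla_bracket p X Y : vf_smooth_at p X -> vf_smooth_at p Y ->
  bracket X Y p = nabla Y p (X p) - nabla X p (Y p).
Proof. by move=> sX sY; rewrite -(levi_civita_torsion_free LC sX sY). Qed.

Lemma nablaN p Y x : vf_smooth_at p Y -> nabla Y p (- x) = - nabla Y p x.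
Proof.
move=> sY; have N0 : nabla Y p 0 = 0.
  have := connection_linear conn (-1) 0 0 sY.
  by rewrite scaler0 addr0 scaleN1r addNr.
by rewrite -[- x]addr0 -scaleN1r (connection_linear conn) // N0 addr0 scaleN1r.
Qed.

Lemma nabla_vectorial V p Y Z x : vf_smooth_at p V -> vf_smooth_at p Y ->
  vf_smooth_at p Z ->
  nabla (cov (vectorial g nabla V) Y Z) p x =
  nabla (cov nabla Y Z) p x
  + dtorsion_term (g p) (V p) (Y p) (Z p) (nabla Y p x) (nabla Z p x) (nabla V p x).
Proof.
move=> sV sY sZ; have sYZ := smooth_inner sY sZ; have sVZ := smooth_inner sV sZ.
(* The minus sign moves into the scalar function so that additivity and the Leibniz rule apply
   literally. *)
have -> : cov (vectorial g nabla V) Y Z = fun q =>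
   (cov nabla Y Z q + inner g Y Z q *: V q) + (- inner g V Z q) *: Y q.
  by apply/funext => q; rewrite scaleNr.
have sc := connection_smooth conn sY sZ.
have s1 := vf_smoothZ sYZ sV; have s2 := vf_smoothZ (smooth_atN sVZ) sY.
have s3 := vf_smoothD sc s1.
rewrite (connection_add conn) // (connection_add conn) //.
rewrite !(connection_leibniz conn) //; last exact: smooth_atN.
rewrite tderivN // !nabla_metric // /dtorsion_term -!addrA; congr (_ + _).
by rewrite !scaleNr opprD addrA.
Qed.

Lemma curvature4_vectorial V X Y Z W p : vf_smooth_at p V -> vf_smooth_at p X ->
  vf_smooth_at p Y -> vf_smooth_at p Z ->
  curvature4 g (vectorial g nabla V) X Y Z W p = curvature4 g nabla X Y Z W p +
  curvature_defect (g p) (V p) (X p) (Y p) (Z p) (W p)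
    (nabla V p (X p)) (nabla V p (Y p)).
Proof.
move=> sV sX sY sZ.
rewrite -(curvature_defectE (glin p) (gsym p) _ _ _ _ _ _ _ (nabla Y p (X p))
  (nabla X p (Y p)) (nabla Z p (X p)) (nabla Z p (Y p))).
rewrite /curvature4 /inner -gDl; congr (g p _ _).
rewrite /curvature.
have cvE A B : cov (vectorial g nabla V) A B p =
   cov nabla A B p + torsion_term (g p) (V p) (A p) (B p).
  by rewrite /cov /vectorial /torsion_term addrA.
rewrite !cvE {1 4}/cov !nabla_vectorial // (nabla_bracket sX sY) /cov.
do 3! move: (nabla (fun=> _) p _) => ?; do ! move: (dtorsion_term _ _ _ _ _ _ _) => ?.
do ! move: (torsion_term _ _ _ _) => ?; move: (nabla Z p _) => ?.
apply/rowP => i; rewrite !mxE; ring.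
Qed.

Lemma bracketC X Y p : bracket Y X p = - bracket X Y p.
Proof. by apply/rowP => j; rewrite !mxE opprB. Qed.

Lemma curvature4C12 X Y Z W p : vector_field X -> vector_field Y ->
  vector_field Z -> curvature4 g nabla X Y Z W p = - curvature4 g nabla Y X Z W p.
Proof.
move=> sX sY sZ; rewrite /curvature4 /inner -gNl; congr (g p _ _).
have E : cov nabla (bracket X Y) Z p = - cov nabla (bracket Y X) Z p.
  by rewrite /cov -nablaN // -bracketC.
by rewrite /curvature E !opprB opprK addrC.
Qed.

Lemma vector_field_cov X Y : vector_field X -> vector_field Y ->
  vector_field (cov nabla X Y).
Proof. by move=> sX sY p; apply: connection_smooth. Qed.

Lemma act_act_inner X Y Z W p : vector_field X -> vector_field Y ->
  vector_field Z -> vector_field W ->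
  act X (act Y (inner g Z W)) p =
  g p (cov nabla X (cov nabla Y Z) p) (W p) + g p (cov nabla Y Z p) (cov nabla X W p)
  + (g p (cov nabla X Z p) (cov nabla Y W p) + g p (Z p) (cov nabla X (cov nabla Y W) p)).
Proof.
move=> sX sY sZ sW.
have sYZ := vector_field_cov sY sZ; have sYW := vector_field_cov sY sW.
have -> : act Y (inner g Z W) = fun q =>
    inner g (cov nabla Y Z) W q + inner g Z (cov nabla Y W) q.
  by apply/funext => q; rewrite /act nabla_metric.
rewrite [LHS]/act tderivD; try exact: smooth_inner.
by rewrite !nabla_metric.
Qed.

(** [X, Y] acts on the function g(Z, W) as a commutator. By metric compatibility the mixed products
    cancel, and what remains is g(R(X,Y)Z, W) + g(Z, R(X,Y)W) = 0. *)
Lemma curvature4C34 X Y Z W p : vector_field X -> vector_field Y ->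
  vector_field Z -> vector_field W ->
  curvature4 g nabla X Y Z W p = - curvature4 g nabla X Y W Z p.
Proof.
move=> sX sY sZ sW.
have := act_bracket (sX p) (sY p) (smooth_inner (sZ p) (sW p)).
rewrite !act_act_inner // {1}/act nabla_metric //.
rewrite /curvature4 /inner /curvature !(gDl, gNl).
rewrite -[nabla Z p _]/(cov nabla (bracket X Y) Z p).
rewrite -[nabla W p _]/(cov nabla (bracket X Y) W p).
rewrite (gsym p (cov nabla X (cov nabla Y W) p)) (gsym p (cov nabla Y (cov nabla X W) p)).
rewrite (gsym p (cov nabla (bracket X Y) W p)).
do ! move: (g p _ _) => ?; lra.
Qed.

(** Torsion freeness is used twice, to exchange Y with Z and then X with [Y, Z]. In the cyclic sum
    of curvatures only the double brackets survive, so the Bianchi identity becomes the Jacobi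
    identity. *)
Lemma nabla_torsion X Y Z p : vector_field X -> vector_field Y -> vector_field Z ->
  cov nabla X (cov nabla Y Z) p =
  cov nabla X (cov nabla Z Y) p + cov nabla (bracket Y Z) X p
  + bracket X (bracket Y Z) p.
Proof.
move=> sX sY sZ; have sB := bracket_smooth sY sZ.
have E : cov nabla Y Z = fun q => cov nabla Z Y q + bracket Y Z q.
  by apply/funext => q; rewrite nabla_bracket // addrC subrK.
have s1 := connection_smooth conn (sZ p) (sY p).
rewrite {1}E {1}/cov (connection_add conn) // -addrA; congr (_ + _).
by rewrite (nabla_bracket (sX p) (sB p)) addrC subrK.
Qed.

Lemma curvature4_bianchi X Y Z W p : vector_field X -> vector_field Y ->
  vector_field Z ->
  curvature4 g nabla X Y Z W p + curvature4 g nabla Y Z X W p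
  + curvature4 g nabla Z X Y W p = 0.
Proof.
move=> sX sY sZ; rewrite /curvature4 /inner -!gDl.
suff -> : curvature nabla X Y Z p + curvature nabla Y Z X p + curvature nabla Z X Y p = 0.
  exact: form0l (glin p) _.
rewrite -[RHS](bracket_jacobi p sX sY sZ) /curvature.
rewrite (nabla_torsion p sX sY sZ) (nabla_torsion p sY sZ sX) (nabla_torsion p sZ sX sY).
do ! move: (cov nabla _ _ p) => ?; do ! move: (bracket _ _ p) => ?.
by apply/rowP => i; rewrite !mxE; ring.
Qed.

Lemma curvature4_pair X Y Z W p : vector_field X -> vector_field Y ->
  vector_field Z -> vector_field W ->
  curvature4 g nabla X Y Z W p = curvature4 g nabla Z W X Y p.
Proof.
move=> sX sY sZ sW.
pose r (x y z w : {X | vector_field X}) :=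
  curvature4 g nabla (sval x) (sval y) (sval z) (sval w) p.
apply: (@curvature_pair_symmetry _ _ r _ _ _
  (exist _ X sX) (exist _ Y sY) (exist _ Z sZ) (exist _ W sW)).
- by move=> [x sx] [y sy] [z sz] w; apply: curvature4C12.
- by move=> [x sx] [y sy] [z sz] [w sw]; apply: curvature4C34.
- by move=> [x sx] [y sy] [z sz] w; apply: curvature4_bianchi.
Qed.

(** * Orthonormal frames and the difference of the Ricci tensors *)

Lemma orthonormal_basis_exists p (U : {vspace 'rV[R]_n}) (m : nat) :
  (forall x, x \in U -> (forall y, y \in U -> g p x y = 0) -> x = 0) ->
  \dim U = m -> exists e : 'I_m -> 'rV[R]_n, orthonormal_basis g p U e.
Proof.
move=> nd dU; have [s bs [os ns]] := ortho_basis_exists (glin p) (gsym p) nd.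
have ss : size s = m.
  by rewrite -dU; have /andP[/eqP <- /eqP ->] := bs.
exists (fun i => nth 0 s i); split; first by rewrite codom_nth.
- by move=> i j ij; apply: os; rewrite ?ss.
- by move=> i; apply: ns; apply: mem_nth; rewrite ss.
Qed.

Lemma orthonormal_frame_exists p : exists E : 'I_n -> M -> 'rV[R]_n,
  (forall i, vf_smooth_at p (E i)) /\
  orthonormal_basis g p fullv (fun i => E i p).
Proof.
have [||e eo] := @orthonormal_basis_exists p fullv n.
- by move=> x _ H; apply: (metric_nondegenerate (s := g) (p := p)) => y; apply: H (memvf _).
- by rewrite dimvf /dim /= mul1n.
exists (fun i => const_extension p (e i)); split=> [i|]; first exact: const_extension_smooth.
have -> // : (fun i => const_extension p (e i) p) = e.
by apply/funext => i; apply: const_extension_self.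
Qed.

(** The set from which [ricci] chooses its frame does not mention the connection, so both Ricci
    tensors use the same frame and are subtracted term by term; [e] is its value at [p]. *)
Lemma ricci_vectorial V X Y p : vf_smooth_at p V -> vf_smooth_at p X ->
  exists2 e : 'I_n -> 'rV[R]_n, orthonormal_basis g p fullv e &
  ricci g (vectorial g nabla V) X Y p - ricci g nabla X Y p =
  (n%:R - 2) * g p (nabla V p (X p)) (Y p)
  + (\sum_i g p (e i) (e i) * g p (nabla V p (e i)) (e i)
     + (2 - n%:R) * inner g V V p) * inner g X Y p
  + (n%:R - 2) * g p (V p) (X p) * g p (V p) (Y p).
Proof.
move=> sV sX.
have [sE oE] := xgetPex (fun _ _ => 0) (orthonormal_frame_exists p).
set E := xget _ _ in sE oE.
exists (fun i => E i p) => //; have [bE Eo E1] := oE.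
have ex u : u = \sum_i (g p (E i p) (E i p) * g p u (E i p)) *: E i p.
  exact: (ortho_expansion (glin p) bE Eo E1 (memvf u)).
have Dl a u u' : nabla V p (a *: u + u') = a *: nabla V p u + nabla V p u'.
  exact: connection_linear.
rewrite -(curvature_defect_trace (glin p) (gsym p) (V p) (X p) (Y p) ex E1 Dl).
rewrite /ricci -sumrB; apply: eq_bigr => i _.
by rewrite curvature4_vectorial // -mulrBr addrC addKr.
Qed.

(** * Symmetry and trace of nabla V over a foliation *)

Section Distribution.
Variables (D : M -> {vspace 'rV[R]_n}) (V : M -> 'rV[R]_n).
Hypothesis D_distribution : is_distribution n.-1 D.
Hypothesis D_involutive : is_involutive D.
Hypothesis sV : vector_field V.
Hypothesis V_perp : forall p x, x \in D p -> g p (V p) x = 0.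
Hypothesis V0 : forall p, inner g V V p != 0.
Hypothesis dV : forall p X, vf_smooth_at p X -> dform (flat g V) V X p = 0.

Lemma distribution_perp p : D p = perp g V p.
Proof.
have [dD _] := D_distribution; apply/eqP; rewrite eqEdim dD dim_perp // leqnn andbT.
by apply/subvP => x xD; rewrite mem_perp V_perp.
Qed.

Let S p x y := g p (nabla V p x) y.

Lemma nablaV_linear p a x y z : S p (a *: x + y) z = a * S p x z + S p y z.
Proof. by rewrite /S (connection_linear conn) ?gDl ?gZl //; apply: sV. Qed.

(** In dV^b(V, X), metric compatibility and torsion freeness cancel g(V, nabla_V X) and leave S(V,
    X) - S(X, V). *)
Lemma nablaV_sym_normal p x : S p (V p) x = S p x (V p).
Proof.
have := dV (@const_extension_smooth p x); rewrite /dform.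
have sX := @const_extension_smooth p x; rewrite {1 2}/act.
rewrite -[tderiv _ _ (V p)]/(tderiv (inner g V (const_extension p x)) p (V p)).
rewrite -[tderiv _ _ (const_extension p x p)]/(tderiv (inner g V V) p (const_extension p x p)).
rewrite !nabla_metric // /flat nabla_bracket // gDr gNr const_extension_self /S.
rewrite (gsym p (V p) (nabla V p x)).
do ! move: (g p _ _) => ?; lra.
Qed.

(** For sections X, Y of D, differentiating g(V, Y) = 0 gives S(x, y) = -g(V, nabla_x Y). The
    antisymmetric part of S is thus -g(V, [X, Y]), zero by involutivity. *)
Lemma nablaV_sym_tangent p x y : g p (V p) x = 0 -> g p (V p) y = 0 -> S p x y = S p y x.
Proof.
move=> Vx Vy; pose X := perp_proj V (const_extension p x); pose Y := perp_proj V (const_extension p y).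
have sX : vf_smooth_at p X by apply: perp_proj_smooth => //; apply: const_extension_smooth.
have sY : vf_smooth_at p Y by apply: perp_proj_smooth => //; apply: const_extension_smooth.
have Xp : X p = x by rewrite /X perp_proj_id const_extension_self.
have Yp : Y p = y by rewrite /Y perp_proj_id const_extension_self.
have XD q : g q (V q) (X q) = 0 by apply: perp_proj_perp.
have YD q : g q (V q) (Y q) = 0 by apply: perp_proj_perp.
have secX : section_at D p X.
  by split=> //; apply: nearW => q; rewrite distribution_perp mem_perp XD.
have secY : section_at D p Y.
  by split=> //; apply: nearW => q; rewrite distribution_perp mem_perp YD.
have := V_perp (D_involutive secX secY).
rewrite nabla_bracket // gDr gNr Xp Yp => B.
have E Z z : (forall q, g q (V q) (Z q) = 0) -> vf_smooth_at p Z ->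
    g p (nabla V p z) (Z p) + g p (V p) (nabla Z p z) = 0.
  move=> Z0 sZ; rewrite -(nabla_metric _ (@sV p) sZ) -[RHS](tderiv_cst p 0 z).
  by apply: tderiv_ext => q; apply: Z0.
have := E _ y XD sX; have := E _ x YD sY; rewrite Xp Yp /S.
move: B; do ! move: (g p _ _) => ?; lra.
Qed.

Lemma nablaV_sym p x y : S p x y = S p y x.
Proof.
have dec z : exists2 z', g p (V p) z' = 0 & exists c, z = c *: V p + z'.
  exists (z - (g p (V p) z / inner g V V p) *: V p).
    by rewrite gDr gNr gZr divfK // subrr.
  by exists (g p (V p) z / inner g V V p); rewrite addrC subrK.
have [x' Vx [a ->]] := dec x; have [y' Vy [c ->]] := dec y.
rewrite !nablaV_linear /S !gDr !gZr -!/(S p _ _).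
rewrite (nablaV_sym_tangent Vx Vy) !nablaV_sym_normal.
ring.
Qed.

(** The derivative of the factor 1/|V| contributes only a multiple of V, which [y] annihilates. *)
Lemma second_ffE p x y : g p (V p) y = 0 ->
  vnorm g V p * second_ff g nabla V p x y = S p x y.
Proof.
move=> Vy; have v0 := vnorm_gt0 (V0 p).
have sN : smooth_at p (fun q => (vnorm g V q)^-1).
  by apply: smooth_at_inv; [rewrite gt_eqF|exact: smooth_vnorm].
rewrite /second_ff (connection_leibniz conn) // ?gDl ?gZl ?Vy ?mulr0 ?add0r.
by rewrite mulVKf // gt_eqF.
Qed.

(** As g(V, V) is nonzero, g is nondegenerate on [D p]; the choice in [metric_trace] therefore
    returns a true orthonormal basis and not its default 0. *)
Lemma mean_curvature_trace p :
  exists2 e : 'I_(\dim (D p)) -> 'rV[R]_n, orthonormal_basis g p (D p) e &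
  mean_curvature g nabla D V p * vnorm g V p =
  \sum_i g p (e i) (e i) * S p (e i) (e i).
Proof.
have nd x : x \in D p -> (forall y, y \in D p -> g p x y = 0) -> x = 0.
  move=> xD H; apply: (metric_nondegenerate (s := g) (p := p)) => y.
  rewrite -[y](subrK ((g p (V p) y / inner g V V p) *: V p)) gDr gZr.
  rewrite (gsym p x (V p)) (V_perp xD) mulr0 addr0; apply: H.
  by rewrite distribution_perp mem_perp gDr gNr gZr divfK ?subrr.
have eo := xgetPex (fun=> 0) (orthonormal_basis_exists nd erefl).
rewrite /mean_curvature /metric_trace; set e := xget _ _ in eo *.
exists e => //; rewrite mulr_suml; apply: eq_bigr => i _.
have [be _ _] := eo.
rewrite -mulrA [_ * vnorm _ _ _]mulrC second_ffE //; apply: V_perp.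
by apply: (basis_mem be); exact: codom_f.
Qed.

Lemma trace_nablaV p (e : 'I_n -> 'rV[R]_n) : orthonormal_basis g p fullv e ->
  \sum_i g p (e i) (e i) * S p (e i) (e i) =
  mean_curvature g nabla D V p * vnorm g V p + S p (V p) (V p) / inner g V V p.
Proof.
move=> [be eo e1]; have [f [bf fo f1] ->] := mean_curvature_trace p.
have c0 := V0 p.
pose s := [seq (g p (e i) (e i), e i) | i <- enum 'I_n].
(* V is not normalised, whence its weight; it accounts for the term S(V, V) / g(V, V). *)
pose t := ((inner g V V p)^-1, V p) ::
  [seq (g p (f i) (f i), f i) | i <- enum 'I_(\dim (D p))].
have es : form_expansion (g p) s fullv.
  move=> x xU; rewrite big_map big_enum /=.
  exact: (ortho_expansion (glin p) be eo e1 xU).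
have et : form_expansion (g p) t fullv.
  move=> x _; rewrite big_cons big_map big_enum /=.
  set x' := x - (g p (V p) x / inner g V V p) *: V p.
  have xD : x' \in D p.
    by rewrite distribution_perp mem_perp gDr gNr gZr divfK ?subrr.
  rewrite (gsym p x (V p)) [_^-1 * _]mulrC.
  have -> : \sum_i (g p (f i) (f i) * g p x (f i)) *: f i = x'.
    rewrite [RHS](ortho_expansion (glin p) bf fo f1 xD); apply: eq_bigr => i _.
    have Vf : g p (V p) (f i) = 0.
      by apply: V_perp; apply: (basis_mem bf); exact: codom_f.
    by rewrite gDl gNl gZl Vf mulr0 subr0.
  by rewrite addrC subrK.
have Sr a x y z : S p z (a *: x + y) = a * S p z x + S p z y.
  by rewrite /S gDr gZr.
have := trace_invariant (gsym p) (nablaV_linear p) Sr es et.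
rewrite /s /t big_map big_enum big_cons big_map big_enum /= => ->.
by rewrite addrC [_ / _]mulrC.
Qed.

Lemma act_vnorm p :
  (vnorm g V p)^-1 * act V (vnorm g V) p = S p (V p) (V p) / inner g V V p.
Proof.
rewrite /act tderiv_vnorm ?nabla_metric //; try exact: sV.
rewrite (gsym p (V p)) -/(S p _ _); have c0 := V0 p.
by move: (inner g V V p) c0 (S _ _ _) => c c0 s; field.
Qed.

Lemma ricci_difference X Y p : vf_smooth_at p X ->
  ricci g (vectorial g nabla V) X Y p - ricci g nabla X Y p =
  (n%:R - 2) * S p (X p) (Y p)
  + (mean_curvature g nabla D V p * vnorm g V p
     + (vnorm g V p)^-1 * act V (vnorm g V) p
     + (2 - n%:R) * inner g V V p) * inner g X Y p
  + (n%:R - 2) * g p (V p) (X p) * g p (V p) (Y p).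
Proof.
move=> sX; have [e eo ->] := ricci_vectorial Y (@sV p) sX.
by rewrite act_vnorm -(trace_nablaV eo).
Qed.

Lemma curvature4_vectorial_pair X Y Z W p : vector_field X -> vector_field Y ->
  vector_field Z -> vector_field W ->
  curvature4 g (vectorial g nabla V) X Y Z W p =
  curvature4 g (vectorial g nabla V) Z W X Y p.
Proof.
move=> sX sY sZ sW; rewrite !curvature4_vectorial; try by
  [apply: sV | apply: sX | apply: sY | apply: sZ | apply: sW].
rewrite curvature4_pair //; congr (_ + _).
by apply: (curvature_defect_pair (gsym p)); apply: nablaV_sym.
Qed.

Lemma ricci_difference_tangent xi eta p : vector_field xi ->
  xi p \in D p -> eta p \in D p ->
  ricci g (vectorial g nabla V) xi eta p - ricci g nabla xi eta p
  = (mean_curvature g nabla D V p * vnorm g V p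
     + (vnorm g V p)^-1 * act V (vnorm g V) p
     + (2 - n%:R) * inner g V V p) * inner g xi eta p
    + (n%:R - 2) * vnorm g V p * second_ff g nabla V p (xi p) (eta p).
Proof.
move=> sx xD eD; rewrite ricci_difference; last exact: sx.
rewrite -second_ffE ?V_perp // mulr0 addr0 addrC; congr (_ + _).
by rewrite mulrA.
Qed.

(** Only (n - 2) S(xi, V) survives g(V, xi) = 0, and xi(g(V, V)) = 2 S(xi, V) gives the factor
    1/2. *)
Lemma ricci_difference_mixed xi p : vector_field xi -> xi p \in D p ->
  ricci g (vectorial g nabla V) xi V p - ricci g nabla xi V p
  = (n%:R - 2) / 2 * act xi (inner g V V) p.
Proof.
move=> sx xD; rewrite ricci_difference; last exact: sx.
rewrite {2}/inner (gsym p (xi p)) (V_perp xD) !mulr0 mul0r !addr0.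
rewrite /act nabla_metric; try exact: sV.
by rewrite (gsym p (V p)) -/(S p _ _); field.
Qed.

(** The two terms in g(V, V)^2 cancel. S(V, V) occurs n - 2 times directly and once through tr S,
    whence n - 1. *)
Lemma ricci_difference_normal p :
  ricci g (vectorial g nabla V) V V p - ricci g nabla V V p
  = inner g V V p * (mean_curvature g nabla D V p * vnorm g V p
      + (n%:R - 1) * ((vnorm g V p)^-1 * act V (vnorm g V) p)).
Proof.
rewrite ricci_difference; last exact: sV.
rewrite act_vnorm -/(inner g V V p); have c0 := V0 p.
move: (inner g V V p) c0 (mean_curvature _ _ _ _ _) (vnorm _ _ _) (S _ _ _) => c c0 h v s.
by field.
Qed.

End Distribution.

End Connection.

End Geometry.

Theorem proposition3p3 (R : realType) (n : nat) (M : smooth_manifold R n)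
    (g : semi_riemannian_metric M)
    (nabla : (M -> 'rV[R]_n) -> M -> 'rV[R]_n -> 'rV[R]_n)
    (nablaLC : is_levi_civita g nabla) :
  (forall V : M -> 'rV[R]_n,
     vector_field V ->
     (forall p, inner g V V p != 0) ->
     (forall p X Y, vf_smooth_at p X -> vf_smooth_at p Y ->
        dform (flat g V) X Y p = 0) ->
     [/\ is_distribution n.-1 (perp g V),
         is_involutive (perp g V) &
         forall X, vector_field X -> (forall p, X p \in perp g V p) ->
         forall p, act X (inner g V V) p = inner g V (bracket X V) p])
  /\
  (forall (D : M -> {vspace 'rV[R]_n}) (V : M -> 'rV[R]_n),
     is_distribution n.-1 D -> is_involutive D ->
     vector_field V ->
     (forall p x, x \in D p -> g p (V p) x = 0) ->
     (forall p, inner g V V p != 0) ->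
     (forall p X, vf_smooth_at p X -> dform (flat g V) V X p = 0) ->
     let nablaV := vectorial g nabla V in
     let H := mean_curvature g nabla D V in
     let II := second_ff g nabla V in
     (forall X Y Z W, vector_field X -> vector_field Y ->
        vector_field Z -> vector_field W ->
        forall p, curvature4 g nablaV X Y Z W p = curvature4 g nablaV Z W X Y p)
     /\
     (forall xi eta, vector_field xi -> vector_field eta ->
        (forall p, xi p \in D p) -> (forall p, eta p \in D p) ->
        forall p,
        ricci g nablaV xi eta p - ricci g nabla xi eta p
        = (H p * vnorm g V p
           + (vnorm g V p)^-1 * act V (vnorm g V) p
           + (2 - n%:R) * inner g V V p) * inner g xi eta p
          + (n%:R - 2) * vnorm g V p * II p (xi p) (eta p))
     /\
     (forall xi, vector_field xi -> (forall p, xi p \in D p) ->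
        forall p,
        ricci g nablaV xi V p - ricci g nabla xi V p
        = (n%:R - 2) / 2 * act xi (inner g V V) p)
     /\
     (forall p,
        ricci g nablaV V V p - ricci g nabla V V p
        = inner g V V p
          * (H p * vnorm g V p
             + (n%:R - 1) * ((vnorm g V p)^-1 * act V (vnorm g V) p)))).
Proof.
split=> [V sV V0 dV|D V DD Di sV VD V0 dV /=].
  split; [exact: perp_distribution|exact: perp_involutive|].
  by move=> X sX XD; apply: act_perp_inner.
split; [|split; [|split]].
- by move=> X Y Z W sX sY sZ sW p; apply: (curvature4_vectorial_pair nablaLC DD).
- by move=> xi eta sx _ xD eD p; apply: (ricci_difference_tangent nablaLC DD).
- by move=> xi sx xD p; apply: (ricci_difference_mixed nablaLC DD).
- by move=> p; apply: (ricci_difference_normal nablaLC DD).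
Qed.
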